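(* Let $a$ be a complex number with $\operatorname{Re} a>0$ and let $m$ be a positive integer. Then $$\gamma_m(a)=\frac{\ln^m a}{2a}-\frac{1}{m+1}\ln^{m+1}a+\frac{1}{2\pi i}\int_0^1\left[\frac{\ln^m\left(a-\frac{\ln(1-u)}{2\pi i}\right)}{a-\frac{\ln(1-u)}{2\pi i}}-\frac{\ln^m\left(a+\frac{\ln(1-u)}{2\pi i}\right)}{a+\frac{\ln(1-u)}{2\pi i}}\right]\frac{du}{u}.$$
   Context: For $\operatorname{Re} a>0$, the Hurwitz zeta function is $\zeta(s,a)=\sum_{n=0}^\infty (n+a)^{-s}$ for $\operatorname{Re} s>1$ (principal branch of powers), continued analytically in $s$ to $\mathbb{C}\setminus\{1\}$ with a simple pole at $s=1$. The Stieltjes constants $\gamma_n(a)$, $n\ge 0$, are defined by the Laurent expansion about $s=1$, $$\zeta(s,a)=\frac{1}{s-1}+\sum_{n=0}^\infty\frac{(-1)^n}{n!}\gamma_n(a)(s-1)^n.$$ $\ln$ denotes the principal branch of the logarithm, and $\ln^m z=(\ln z)^m$. *)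

(* Defs.v *)
From Stdlib Require Import Reals Factorial.
From Coquelicot Require Import Coquelicot.

Local Open Scope C_scope.

Definition Cexp (z : C) : C :=
  RtoC (exp (Re z)) * (cos (Im z), sin (Im z)).

(* Principal argument, with values in (-PI, PI] for z <> 0. *)
Definition Carg (z : C) : R :=
  if Rle_dec 0 (Im z) then acos (Re z / Cmod z) else (- acos (Re z / Cmod z))%R.

Definition Cln (z : C) : C := (ln (Cmod z), Carg z).

(* Principal branch of z ^ w for z <> 0. *)
Definition Cpower (z w : C) : C := Cexp (w * Cln z).

(* zeta is the function s |-> zeta(s, a): the Hurwitz series on Re s > 1,
   continued analytically to C \ {1}.  By the identity theorem at most one
   function on C \ {1} satisfies this; its value at s = 1 is left free. *)
Definition is_hurwitz_zeta (a : C) (zeta : C -> C) : Prop :=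
  (forall s : C, (1 < Re s)%R ->
     is_series (K := C_AbsRing) (V := C_NormedModule)
       (fun n : nat => Cpower (RtoC (INR n) + a) (- s)) (zeta s)) /\
  (forall s : C, s <> RtoC 1 ->
     ex_derive (K := C_AbsRing) (V := C_NormedModule) zeta s).

(* Laurent expansion of zeta on some punctured disc about s = 1; it
   determines the sequence gamma. *)
Definition are_stieltjes_constants (zeta : C -> C) (gamma : nat -> C) : Prop :=
  exists r : R, (0 < r)%R /\
    forall s : C, (0 < Cmod (s - RtoC 1) < r)%R ->
      exists S : C,
        is_series (K := C_AbsRing) (V := C_NormedModule)
          (fun n : nat =>
             RtoC ((-1) ^ n / INR (fact n))%R * gamma n * (s - RtoC 1) ^ n) S /\
        zeta s = RtoC 1 / (s - RtoC 1) + S.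

Definition log_quotient (m : nat) (z : C) : C := Cln z ^ m / z.

(* Only the values on 0 < u < 1 matter: the points u = 0 and u = 1, where
   totalized division and logarithm are used, do not affect the integral. *)
Definition stieltjes_integrand (a : C) (m : nat) (u : R) : C :=
  (log_quotient m (a - RtoC (ln (1 - u)) / (RtoC (2 * PI) * Ci))
   - log_quotient m (a + RtoC (ln (1 - u)) / (RtoC (2 * PI) * Ci)))
  / RtoC u.

(* Main.v *)
(* For s = 1 + t with t > 0, Hermite's formula
     zeta(s, a) = a^-s / 2 + a^(1-s) / (s-1)
        + (1 / (2 pi i)) int_0^1 [(a - i y)^-s - (a + i y)^-s] du / u,
     y = - ln (1-u) / (2 pi),
   is expanded in powers of t; comparing with the Laurent series gives gamma_m,
   and real t suffices, so that the analytic continuation of zeta is not used.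

   Both sides of Hermite's formula tend to 0 as a moves to the right, so it is
   enough to compare the right-hand sides at a and a + 1, i.e. to compute the
   error of the trapezoidal rule for f(z) = z^-s on [a, a+1].  Cauchy's theorem
   in the two half-strips over and under this segment turns the k-th Fourier
   coefficient of f into an integral of f(a +- i y) - f(a+1 +- i y) against
   exp(-2 pi k y), i.e. against (1-u)^k.  On one side the sum over k is a
   geometric series, which produces the 1/u; on the other it is Dirichlet's
   theorem at the end points of the interval. *)
Require Import Defs.
From Stdlib Require Import Reals Lra Lia Factorial.
From Coquelicot Require Import Coquelicot.
Local Open Scope C_scope.

(** * Calculus of complex functions of a real variable *)

(** No infinite sum is interchanged with an integral. For finitely many modes the geometric sum is
    exact, u * sum_{j<=N} (1-u)^j = 1 - (1-u)^(N+1), and the leftover (1-u)^(N+1) contributes O(1/N)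
    because the integrand is bounded: near u = 0 the difference of the two values of [q] is O(u),
    which pays for the factor 1/u, and near u = 1 these values stay bounded although the height
    tends to infinity. On the Fourier side the periodic extension of f jumps at the end points;
    subtracting the linear interpolant, which every cosine mode annihilates, leaves a function with
    zeros at both ends. Nor is the integral differentiated in t. The power z^(-1-t) is expanded to
    order m with a remainder O(t^(m+1)), uniform on Re z >= Re a: for t <= 1/2 the exponential in
    the remainder is at most exp(|ln z|/2), which the factor 1/|z| absorbs together with the powers
    of |ln z|. Two polynomials of degree m in t that differ by O(t^(m+1)) as t decreases to 0 have
    the same coefficients. *)

Lemma C_eq (z w : C) : Re z = Re w -> Im z = Im w -> z = w.
Proof. destruct z, w; simpl; intros; subst; reflexivity. Qed.

Lemma Re_mult (z w : C) : Re (z * w) = (Re z * Re w - Im z * Im w)%R.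
Proof. reflexivity. Qed.

Lemma Im_mult (z w : C) : Im (z * w) = (Re z * Im w + Im z * Re w)%R.
Proof. reflexivity. Qed.

Lemma Cmod_le_Re_Im (z : C) (M : R) :
  (Rabs (Re z) <= M)%R -> (Rabs (Im z) <= M)%R -> (Cmod z <= 2 * M)%R.
Proof.
  intros H1 H2.
  replace z with (RtoC (Re z) + Ci * RtoC (Im z))
    by (apply C_eq; simpl; ring).
  eapply Rle_trans; [apply Cmod_triangle|].
  rewrite Cmod_mult, Cmod_Ci, !Cmod_R; lra.
Qed.

Lemma im_le_Cmod (z : C) : (Rabs (Im z) <= Cmod z)%R.
Proof.
  eapply Rle_trans; [|apply Rmax_Cmod]; apply Rmax_r.
Qed.

Lemma Re_pos_neq_0 (z : C) : (0 < Re z)%R -> z <> 0.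
Proof. intros H E; rewrite E in H; simpl in H; lra. Qed.

Lemma Cmod_sqrt (z : C) : (Cmod z * Cmod z = Re z * Re z + Im z * Im z)%R.
Proof. generalize (Cmod2_alt z); simpl; lra. Qed.

(** A pair of real derivatives, so that [auto_derive], the mean value theorem and differentiation
    under the integral sign apply componentwise. *)
Definition is_Cderive (f : R -> C) (t : R) (l : C) : Prop :=
  is_derive (fun x => Re (f x)) t (Re l) /\ is_derive (fun x => Im (f x)) t (Im l).

Lemma is_Cderive_ext_loc (f g : R -> C) (t : R) (l : C) :
  locally t (fun x => f x = g x) -> is_Cderive f t l -> is_Cderive g t l.
Proof.
  intros H [H1 H2]; split; (eapply is_derive_ext_loc; [|eassumption]);

  (eapply filter_imp; [|exact H]); intros x ->; reflexivity.
Qed.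

Lemma is_Cderive_ext (f g : R -> C) (t : R) (l : C) :
  (forall x, f x = g x) -> is_Cderive f t l -> is_Cderive g t l.
Proof. intros H; apply is_Cderive_ext_loc, filter_forall, H. Qed.

Lemma is_Cderive_eq (f : R -> C) (t : R) (l l' : C) :
  is_Cderive f t l -> l = l' -> is_Cderive f t l'.
Proof. intros H <-; exact H. Qed.

Lemma is_Cderive_const (c : C) (t : R) : is_Cderive (fun _ => c) t 0.
Proof. split; simpl; auto_derive; trivial. Qed.

Lemma is_Cderive_RtoC (f : R -> R) (t l : R) :
  is_derive f t l -> is_Cderive (fun x => RtoC (f x)) t (RtoC l).
Proof. intros H; split; simpl; [exact H|auto_derive; trivial]. Qed.

Lemma is_Cderive_plus (f g : R -> C) (t : R) (lf lg : C) :
  is_Cderive f t lf -> is_Cderive g t lg ->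
  is_Cderive (fun x => f x + g x) t (lf + lg).
Proof.
  intros [F1 F2] [G1 G2]; split; simpl.
  - exact (is_derive_plus _ _ _ _ _ F1 G1).
  - exact (is_derive_plus _ _ _ _ _ F2 G2).
Qed.

(** [auto_derive] leaves the derivative of an abstract function as [Derive] of its eta-expansion;
    the [change] brings [H] into this shape so that [rewrite] finds it. *)
Ltac rewrite_derive H :=
  apply is_derive_unique in H;
  match type of H with Derive ?u ?t = ?l =>
    change (Derive (fun x : R => u x) t = l) in H
  end;
  rewrite ?H.

Lemma is_Cderive_mult (f g : R -> C) (t : R) (lf lg : C) :
  is_Cderive f t lf -> is_Cderive g t lg ->
  is_Cderive (fun x => f x * g x) t (lf * g t + f t * lg).
Proof.
  intros [F1 F2] [G1 G2].
  pose (u := fun x => Re (f x)); pose (v := fun x => Im (f x)).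
  change (is_derive u t (Re lf)) in F1; change (is_derive v t (Im lf)) in F2.
  pose (w := fun x => Re (g x)); pose (z := fun x => Im (g x)).
  change (is_derive w t (Re lg)) in G1; change (is_derive z t (Im lg)) in G2.
  split.
  - apply (is_derive_ext (fun x => u x * w x - v x * z x)%R);
      [reflexivity|].
    auto_derive.
    + repeat split; eexists; eassumption.
    + rewrite_derive F1; rewrite_derive F2;
      rewrite_derive G1; rewrite_derive G2; unfold u, v, w, z; simpl.
      unfold Re, Im; ring.
  - apply (is_derive_ext (fun x => u x * z x + v x * w x)%R);
      [reflexivity|].
    auto_derive.
    + repeat split; eexists; eassumption.
    + rewrite_derive F1; rewrite_derive F2;
      rewrite_derive G1; rewrite_derive G2; unfold u, v, w, z; simpl.
      unfold Re, Im; ring.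
Qed.

Lemma is_Cderive_scal (c : C) (f : R -> C) (t : R) (l : C) :
  is_Cderive f t l -> is_Cderive (fun x => c * f x) t (c * l).
Proof.
  intros H; eapply is_Cderive_eq;
    [apply is_Cderive_mult; [apply is_Cderive_const|exact H]|cbv beta; ring].
Qed.

Lemma is_Cderive_opp (f : R -> C) (t : R) (l : C) :
  is_Cderive f t l -> is_Cderive (fun x => - f x) t (- l).
Proof.
  intros H; apply (is_Cderive_ext (fun x => (-(1)) * f x)); [intros; ring|].
  eapply is_Cderive_eq; [apply is_Cderive_scal, H|ring].
Qed.

Lemma is_Cderive_minus (f g : R -> C) (t : R) (lf lg : C) :
  is_Cderive f t lf -> is_Cderive g t lg ->
  is_Cderive (fun x => f x - g x) t (lf - lg).
Proof. intros F G; apply is_Cderive_plus, is_Cderive_opp; assumption. Qed.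

Lemma is_Cderive_Cexp (f : R -> C) (t : R) (l : C) :
  is_Cderive f t l -> is_Cderive (fun x => Cexp (f x)) t (l * Cexp (f t)).
Proof.
  intros [F1 F2].
  pose (u := fun x => Re (f x)); pose (v := fun x => Im (f x)).
  change (is_derive u t (Re l)) in F1; change (is_derive v t (Im l)) in F2.
  split.
  - apply (is_derive_ext (fun x => exp (u x) * cos (v x))%R);
      [intros; unfold u, v, Cexp, Re, Im; simpl; ring|].
    auto_derive.
    + repeat split; eexists; eassumption.
    + rewrite_derive F1; rewrite_derive F2; unfold u, v; simpl.
      unfold Re, Im; ring.
  - apply (is_derive_ext (fun x => exp (u x) * sin (v x))%R);
      [intros; unfold u, v, Cexp, Re, Im; simpl; ring|].
    auto_derive.
    + repeat split; eexists; eassumption.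
    + rewrite_derive F1; rewrite_derive F2; unfold u, v; simpl.
      unfold Re, Im; ring.
Qed.

Lemma sqrt_1_tan (z : C) :
  (0 < Re z)%R -> sqrt (1 + (Im z / Re z)²) = (Cmod z / Re z)%R.
Proof.
  intros Hz.
  assert (H0 : (0 < Cmod z)%R) by (apply Cmod_gt_0, Re_pos_neq_0, Hz).
  apply Rsqr_inj.
  - apply sqrt_pos.
  - apply Rlt_le, Rdiv_lt_0_compat; assumption.
  - rewrite Rsqr_sqrt by (generalize (Rle_0_sqr (Im z / Re z)); lra).
    unfold Rsqr.
    replace (Cmod z / Re z * (Cmod z / Re z))%R
      with ((Cmod z * Cmod z) / (Re z * Re z))%R by (field; lra).
    rewrite Cmod_sqrt; field; lra.
Qed.

(** On the right half-plane the two [acos] branches of [Carg] merge into one formula that is smooth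
    across the real axis; derivative and continuity of [Cln] both rest on it. *)
Lemma Carg_atan (z : C) : (0 < Re z)%R -> Carg z = atan (Im z / Re z).
Proof.
  intros Hz.
  assert (H0 : (0 < Cmod z)%R) by (apply Cmod_gt_0, Re_pos_neq_0, Hz).
  assert (Hc : (Re z / Cmod z = cos (atan (Im z / Re z)))%R).
  { rewrite cos_atan, sqrt_1_tan by exact Hz; field; lra. }
  unfold Carg; rewrite Hc.
  assert (B := atan_bound (Im z / Re z)).
  destruct Rle_dec as [H|H].
  - apply acos_cos; split; [|lra].
    destruct (Req_dec (Im z) 0) as [E|E].
    + rewrite E; unfold Rdiv; rewrite Rmult_0_l, atan_0; lra.
    + rewrite <- atan_0; apply Rlt_le, atan_increasing, Rdiv_lt_0_compat; lra.
  - rewrite <- cos_neg, acos_cos; [ring|split; [|lra]].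
    apply Rnot_le_lt in H.
    assert (atan (Im z / Re z) < atan 0)%R.
    { apply atan_increasing.
      replace 0%R with (0 / Re z)%R by (field; lra).
      apply Rmult_lt_compat_r; [apply Rinv_0_lt_compat|]; assumption. }
    rewrite atan_0 in *; lra.
Qed.

Lemma Cexp_Cln (z : C) : (0 < Re z)%R -> Cexp (Cln z) = z.
Proof.
  intros Hz.
  assert (H0 : (0 < Cmod z)%R) by (apply Cmod_gt_0, Re_pos_neq_0, Hz).
  unfold Cexp, Cln; cbn [Re Im fst snd].
  rewrite Carg_atan, exp_ln, cos_atan, sin_atan, sqrt_1_tan by assumption.
  apply C_eq; cbn [Re Im fst snd RtoC Cmult]; unfold Re, Im in *; field; lra.
Qed.

Lemma is_Cderive_inv (f : R -> C) (t : R) (l : C) :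
  f t <> 0 -> is_Cderive f t l ->
  is_Cderive (fun x => / f x) t (- l / (f t * f t)).
Proof.
  intros H0 [F1 F2].
  pose (u := fun x => Re (f x)); pose (v := fun x => Im (f x)).
  change (is_derive u t (Re l)) in F1; change (is_derive v t (Im l)) in F2.
  assert (Hn : (Re (f t) * Re (f t) + Im (f t) * Im (f t) <> 0)%R).
  { rewrite <- Cmod_sqrt; apply Cmod_gt_0 in H0; nra. }
  split.
  - apply (is_derive_ext
      (fun x => u x / (u x * u x + v x * v x))%R);
      [intros; unfold u, v, Re, Im; simpl; f_equal; f_equal; ring|].
    auto_derive.
    + repeat split; try (eexists; eassumption); exact Hn.
    + rewrite_derive F1; rewrite_derive F2; unfold u, v; simpl.
      unfold Re, Im in *; field.
      repeat split; nra.
  - apply (is_derive_ext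
      (fun x => - v x / (u x * u x + v x * v x))%R);
      [intros; unfold u, v, Re, Im; simpl; f_equal; f_equal; ring|].
    auto_derive.
    + repeat split; try (eexists; eassumption); exact Hn.
    + rewrite_derive F1; rewrite_derive F2; unfold u, v; simpl.
      unfold Re, Im in *; field.
      repeat split; nra.
Qed.

Lemma is_Cderive_Cln (f : R -> C) (t : R) (l : C) :
  (0 < Re (f t))%R -> is_Cderive f t l ->
  is_Cderive (fun x => Cln (f x)) t (l / f t).
Proof.
  intros H0 [F1 F2].
  pose (u := fun x => Re (f x)); pose (v := fun x => Im (f x)).
  change (is_derive u t (Re l)) in F1; change (is_derive v t (Im l)) in F2.
  assert (Hn : (0 < Re (f t) * Re (f t) + Im (f t) * Im (f t))%R).
  { generalize (Rle_0_sqr (Im (f t))); unfold Rsqr; nra. }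
  split.
  - apply (is_derive_ext
      (fun x => ln (sqrt (u x * u x + v x * v x)))%R);
      [intros; unfold u, v, Re, Im, Cln, Cmod; cbn [fst snd]; do 2 f_equal; ring|].
    auto_derive.
    + repeat split; try (eexists; eassumption); try exact Hn.
      apply sqrt_lt_R0, Hn.
    + rewrite_derive F1; rewrite_derive F2; unfold u, v; cbv beta.
      set (s := (Re (f t) * Re (f t) + Im (f t) * Im (f t))%R) in *.
      assert (Hs := sqrt_lt_R0 _ Hn).
      replace (/ (2 * sqrt s) * / sqrt s)%R with (/ (2 * (sqrt s * sqrt s)))%R
        by (field; lra).
      transitivity ((Re l * Re (f t) + Im l * Im (f t)) * / (sqrt s * sqrt s))%R;
        [unfold Re, Im; field; lra|].
      rewrite sqrt_sqrt by lra.
      unfold s, Re, Im in *; simpl; field; repeat split; nra.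
  (* The [atan] formula for the argument holds only where the real part is positive, so the
     derivative is transferred on a neighbourhood of [t] where [u] stays positive. *)
  - apply (is_derive_ext_loc (fun x => atan (v x / u x))).
    + assert (C0 : continuous u t)
        by (apply (ex_derive_continuous (V := R_NormedModule)); eexists; exact F1).
      assert (P : locally (u t) (fun y => 0 < y)%R)
        by (apply open_gt; exact H0).
      eapply filter_imp; [|exact (C0 _ P)].
      intros x Hx; symmetry; apply Carg_atan, Hx.
    + auto_derive.
      * repeat split; try (eexists; eassumption).
        unfold u; lra.
      * rewrite_derive F1; rewrite_derive F2; unfold u, v.
        unfold Re, Im, Rsqr in *; simpl; field; repeat split; nra.
Qed.

(** * Continuity of complex-valued functions *)

Definition Ccontinuous {U : UniformSpace} (f : U -> C) (x : U) : Prop :=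
  continuous (fun y => Re (f y)) x /\ continuous (fun y => Im (f y)) x.

Lemma is_Cderive_continuous (f : R -> C) (t : R) (l : C) :
  is_Cderive f t l -> Ccontinuous f t.
Proof.
  intros [H1 H2]; split;
    apply (ex_derive_continuous (V := R_NormedModule)); eexists; eassumption.
Qed.

Lemma continuous_real_comp {U : UniformSpace} (h : R -> R) (f : U -> R) (x : U) :
  ex_derive h (f x) -> continuous f x -> continuous (fun y => h (f y)) x.
Proof.
  intros H Hf; apply (continuous_comp f h); [exact Hf|].
  apply (ex_derive_continuous (V := R_NormedModule)), H.
Qed.

Lemma continuous_Rmult {U : UniformSpace} (f g : U -> R) (x : U) :
  continuous f x -> continuous g x -> continuous (fun y => f y * g y)%R x.
Proof. apply (continuous_mult (K := R_AbsRing)). Qed.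

Lemma continuous_Rplus {U : UniformSpace} (f g : U -> R) (x : U) :
  continuous f x -> continuous g x -> continuous (fun y => f y + g y)%R x.
Proof. apply (continuous_plus (V := R_NormedModule)). Qed.

Lemma continuous_Rminus {U : UniformSpace} (f g : U -> R) (x : U) :
  continuous f x -> continuous g x -> continuous (fun y => f y - g y)%R x.
Proof. apply (continuous_minus (V := R_NormedModule)). Qed.

Section Continuity.
Context {U : UniformSpace}.
Implicit Types (f g : U -> C) (x : U).

Lemma Ccontinuous_ext_loc f g x :
  locally x (fun y => f y = g y) -> Ccontinuous f x -> Ccontinuous g x.
Proof.
  intros H [H1 H2]; split;
    [refine (continuous_ext_loc _ _ _ _ H1)|refine (continuous_ext_loc _ _ _ _ H2)];
    (eapply filter_imp; [|exact H]); intros y Hy; cbv beta in Hy |- *;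
    rewrite Hy; reflexivity.
Qed.

Lemma Ccontinuous_const (c : C) x : Ccontinuous (fun _ => c) x.
Proof. split; apply continuous_const. Qed.

Lemma Ccontinuous_RtoC (f : U -> R) x :
  continuous f x -> Ccontinuous (fun y => RtoC (f y)) x.
Proof. split; [assumption|apply continuous_const]. Qed.

Lemma Ccontinuous_plus f g x :
  Ccontinuous f x -> Ccontinuous g x -> Ccontinuous (fun y => f y + g y) x.
Proof. intros [F1 F2] [G1 G2]; split; apply continuous_Rplus; assumption. Qed.

Lemma Ccontinuous_mult f g x :
  Ccontinuous f x -> Ccontinuous g x -> Ccontinuous (fun y => f y * g y) x.
Proof.
  intros [F1 F2] [G1 G2]; split.
  - apply continuous_Rminus; apply continuous_Rmult; assumption.
  - apply continuous_Rplus; apply continuous_Rmult; assumption.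
Qed.

Lemma Ccontinuous_opp f x : Ccontinuous f x -> Ccontinuous (fun y => - f y) x.
Proof.
  intros [F1 F2]; split; apply (continuous_opp (V := R_NormedModule)); assumption.
Qed.

Lemma Ccontinuous_minus f g x :
  Ccontinuous f x -> Ccontinuous g x -> Ccontinuous (fun y => f y - g y) x.
Proof. intros F G; apply Ccontinuous_plus, Ccontinuous_opp; assumption. Qed.

Lemma Ccontinuous_inv f x :
  f x <> 0 -> Ccontinuous f x -> Ccontinuous (fun y => / f y) x.
Proof.
  intros H0 [F1 F2].
  assert (Hn : (Re (f x) ^ 2 + Im (f x) ^ 2 <> 0)%R).
  { rewrite <- Cmod2_alt; apply pow_nonzero.
    apply Cmod_gt_0 in H0; lra. }
  assert (Hd : continuous (fun y => / (Re (f y) ^ 2 + Im (f y) ^ 2))%R x).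
  { apply (continuous_real_comp Rinv (fun y => Re (f y) ^ 2 + Im (f y) ^ 2)%R).
    - auto_derive; exact Hn.
    - apply continuous_Rplus;
        apply (continuous_real_comp (fun t => t ^ 2)%R);
        try assumption; auto_derive; trivial. }
  split.
  - apply (continuous_Rmult (fun y => Re (f y))); assumption.
  - apply (continuous_Rmult (fun y => - Im (f y))%R); [|assumption].
    apply (continuous_opp (V := R_NormedModule)); assumption.
Qed.

Lemma Ccontinuous_div f g x :
  g x <> 0 -> Ccontinuous f x -> Ccontinuous g x ->
  Ccontinuous (fun y => f y / g y) x.
Proof.
  intros; apply Ccontinuous_mult; [|apply Ccontinuous_inv]; assumption.
Qed.

Lemma Ccontinuous_Cexp f x :
  Ccontinuous f x -> Ccontinuous (fun y => Cexp (f y)) x.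
Proof.
  intros [F1 F2].
  apply (Ccontinuous_mult (fun y => RtoC (exp (Re (f y))))
    (fun y => (cos (Im (f y)), sin (Im (f y))))).
  - apply Ccontinuous_RtoC, continuous_real_comp; [auto_derive; trivial|assumption].
  - split; apply continuous_real_comp; try assumption; auto_derive; trivial.
Qed.

Lemma Ccontinuous_Cln f x :
  (0 < Re (f x))%R -> Ccontinuous f x -> Ccontinuous (fun y => Cln (f y)) x.
Proof.
  intros H0 [F1 F2].
  assert (Hn : (0 < Re (f x) ^ 2 + Im (f x) ^ 2)%R).
  { assert (H := pow2_ge_0 (Im (f x))); nra. }
  split.
  - apply (continuous_real_comp (fun t => ln (sqrt t))
      (fun y => Re (f y) ^ 2 + Im (f y) ^ 2)%R).
    + auto_derive; repeat split; [exact Hn|apply sqrt_lt_R0, Hn].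
    + apply continuous_Rplus;
        apply (continuous_real_comp (fun t => t ^ 2)%R);
        try assumption; auto_derive; trivial.
  - apply (continuous_ext_loc _ (fun y => atan (Im (f y) * / Re (f y)))).
    + assert (P : locally (Re (f x)) (fun y => 0 < y)%R)
        by (apply open_gt; exact H0).
      eapply filter_imp; [|exact (F1 _ P)].
      intros y Hy; symmetry; apply Carg_atan, Hy.
    + apply (continuous_real_comp atan); [auto_derive; trivial|].
      apply continuous_Rmult; [assumption|].
      apply (continuous_real_comp Rinv); [auto_derive; lra|assumption].
Qed.

End Continuity.

(* Holomorphy on the right half-plane, phrased along paths: since every
   contour below is parametrized by a real variable, the chain rule along
   real curves is all that is needed of the complex derivative. *)
Definition is_rhp_derive (q q' : C -> C) : Prop :=
  forall (p : R -> C) (t : R) (l : C),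
    (0 < Re (p t))%R -> is_Cderive p t l ->
    is_Cderive (fun x => q (p x)) t (l * q' (p t)).

(** The domain is an arbitrary uniform space because Green's identity asks for joint continuity on
    the plane [R * R], not only along real curves. *)
Definition rhp_continuous (q : C -> C) : Prop :=
  forall (U : UniformSpace) (p : U -> C) (x : U),
    (0 < Re (p x))%R -> Ccontinuous p x -> Ccontinuous (fun y => q (p y)) x.

Lemma Rabs_mean_value (h h' : R -> R) (a b K : R) :
  (a <= b)%R ->
  (forall x, (a <= x <= b)%R -> is_derive h x (h' x) /\ (Rabs (h' x) <= K)%R) ->
  (Rabs (h b - h a) <= K * (b - a))%R.
Proof.
  intros Hab H.
  destruct (MVT_gen h a b h') as (c & Hc & E).
  - rewrite Rmin_left, Rmax_right by lra; intros; apply H; lra.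
  - rewrite Rmin_left, Rmax_right by lra; intros x Hx.
    apply derivable_continuous_pt.
    exists (h' x); apply is_derive_Reals, H, Hx.
  - rewrite Rmin_left, Rmax_right in Hc by lra.
    rewrite E, Rabs_mult, (Rabs_pos_eq (b - a)) by lra.
    apply Rmult_le_compat_r; [lra|apply H, Hc].
Qed.

(** The mean value theorem is applied to real and imaginary parts separately; the crude factor 2
    comes from recombining them and is the origin of the powers of 2 in the later bounds. *)
Lemma is_Cderive_mean_value (f : R -> C) (f' : R -> C) (a b M : R) :
  (a <= b)%R ->
  (forall t, (a <= t <= b)%R -> is_Cderive f t (f' t) /\ (Cmod (f' t) <= M)%R) ->
  (Cmod (f b - f a) <= 2 * (M * (b - a)))%R.
Proof.
  intros Hab H.
  apply Cmod_le_Re_Im.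
  - apply (Rabs_mean_value (fun x => Re (f x)) (fun x => Re (f' x))); [exact Hab|].
    intros t Ht; destruct (H t Ht) as [[H1 H2] H3]; split; [exact H1|].
    eapply Rle_trans; [apply re_le_Cmod|exact H3].
  - apply (Rabs_mean_value (fun x => Im (f x)) (fun x => Im (f' x))); [exact Hab|].
    intros t Ht; destruct (H t Ht) as [[H1 H2] H3]; split; [exact H2|].
    eapply Rle_trans; [apply im_le_Cmod|exact H3].
Qed.

(** Convexity of the half-plane keeps the segment from [z] to [w] inside it, and the bound on [q']
    is asked for on this segment only. *)
Lemma rhp_mean_value (q q' : C -> C) (z w : C) (M : R) :
  is_rhp_derive q q' -> (0 < Re z)%R -> (0 < Re w)%R ->
  (forall t, (0 <= t <= 1)%R -> (Cmod (q' (z + RtoC t * (w - z))%C) <= M)%R) ->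
  (Cmod (q w - q z) <= 2 * (M * Cmod (w - z)))%R.
Proof.
  intros Hq Hz Hw HM.
  assert (E := is_Cderive_mean_value (fun t => q (z + RtoC t * (w - z)))
    (fun t => (w - z) * q' (z + RtoC t * (w - z))) 0 1 (Cmod (w - z) * M)%R).
  cbv beta in E.
  replace (z + RtoC 1 * (w - z)) with w in E by ring.
  replace (z + RtoC 0 * (w - z)) with z in E by ring.
  eapply Rle_trans; [apply E; [lra|]|apply Req_le; ring].
  intros t Ht; split.
  - apply (Hq (fun t => z + RtoC t * (w - z))).
    + replace (Re (z + RtoC t * (w - z)))
        with ((1 - t) * Re z + t * Re w)%R
        by (simpl; unfold Re; ring).
      destruct (Req_dec t 1) as [->|Ht1]; [lra|].
      assert (0 < (1 - t) * Re z)%R by (apply Rmult_lt_0_compat; lra).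
      assert (0 <= t * Re w)%R by (apply Rmult_le_pos; lra).
      lra.
    + eapply is_Cderive_eq.
      * apply is_Cderive_plus; [apply is_Cderive_const|].
        apply is_Cderive_mult; [|apply is_Cderive_const].
        apply is_Cderive_RtoC, is_derive_id.
      * change (@one R_AbsRing) with 1%R; cbv beta; ring.
  - rewrite Cmod_mult; apply Rmult_le_compat_l; [apply Cmod_ge_0|auto].
Qed.

(** * Integrals of complex functions *)

Lemma is_RInt_Rconst (a b c : R) : is_RInt (fun _ => c) a b ((b - a) * c)%R.
Proof. apply (is_RInt_const (V := R_NormedModule)). Qed.

(** If |f - g| <= w, then the Riemann sums of [f] and [g] differ by at most that of [w]. Those of
    [g] and [w] converge and the integral of [w] is small, so the Riemann sums of [f] form a Cauchy
    family. *)
Lemma ex_RInt_approx (f : R -> R) (a b : R) :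
  (a <= b)%R ->
  (forall eps : posreal, exists (g w : R -> R) (Iw : R),
     ex_RInt g a b /\ is_RInt w a b Iw /\ (Iw < eps)%R /\
     forall x, (a <= x <= b)%R -> (Rabs (f x - g x) <= w x)%R) ->
  ex_RInt f a b.
Proof.
  intros Hab H.
  set (S := fun (h : R -> R) (P : SF_seq) => scal (sign (b - a)) (Riemann_sum h P)).
  apply (proj1 (filterlim_locally_cauchy (U := R_CompleteSpace)
    (F := Riemann_fine a b) (S f))).
  intros eps.
  (* A Riemann sum of [f] is within 3 * (eps/8) of [Ig]: one eighth for [g], one for [w] and one for
     [Iw] itself. Two such sums are then less than [eps] apart. *)
  assert (He : (0 < eps / 8)%R) by (generalize (cond_pos eps); lra).
  destruct (H (mkposreal _ He)) as (g & w & Iw & [Ig Hg] & Hw & HI & Hfg).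
  simpl in HI.
  assert (Hg' := proj1 (filterlim_locally (U := R_UniformSpace) _ _) Hg (mkposreal _ He)).
  assert (Hw' := proj1 (filterlim_locally (U := R_UniformSpace) _ _) Hw (mkposreal _ He)).
  set (adm := fun P : SF_seq => pointed_subdiv P /\ SF_h P = Rmin a b
    /\ seq.last (SF_h P) (SF_lx P) = Rmax a b).
  exists (fun P => (ball Ig (eps / 8) (S g P) /\ ball Iw (eps / 8) (S w P)) /\ adm P)%R.
  assert (key : forall P, (ball (M := R_UniformSpace) Ig (eps / 8) (S g P)
      /\ ball (M := R_UniformSpace) Iw (eps / 8) (S w P))%R /\ adm P ->
      (Rabs (S f P - Ig) < 3 * (eps / 8))%R).
  { intros P [[BG BW] [A1 [A2 A3]]].
    rewrite Rmin_left in A2 by exact Hab; rewrite Rmax_right in A3 by exact Hab.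
    change (Rabs (S g P - Ig) < eps / 8)%R in BG.
    change (Rabs (S w P - Iw) < eps / 8)%R in BW.
    assert (N : (Rabs (S f P - S g P) <= S w P)%R).
    { unfold S; destruct (Req_dec a b) as [E|E].
      - replace (b - a)%R with 0%R by lra; rewrite sign_0.
        change (Rabs (0 * Riemann_sum f P - 0 * Riemann_sum g P)
          <= 0 * Riemann_sum w P)%R.
        rewrite !Rmult_0_l, Rminus_0_r, Rabs_R0; lra.
      - rewrite sign_eq_1 by lra.
        change (Rabs (1 * Riemann_sum f P - 1 * Riemann_sum g P)
          <= 1 * Riemann_sum w P)%R.
        rewrite !Rmult_1_l.
        assert (X := Riemann_sum_norm (V := R_NormedModule)
          (fun x => minus (f x) (g x)) w P A1).
        replace (Riemann_sum f P - Riemann_sum g P)%R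
          with (Riemann_sum (V := R_NormedModule) (fun x => minus (f x) (g x)) P)
          by exact (Riemann_sum_minus (V := R_NormedModule) f g P).
        apply X; intros t Ht; apply Hfg.
        rewrite <- A2, <- A3; exact Ht. }
    apply Rabs_def2 in BG; apply Rabs_def2 in BW.
    apply Rabs_le_between in N; apply Rabs_def1; lra. }
  split.
  - unfold Riemann_fine, within in *.
    eapply filter_imp; [|apply (filter_and _ _ Hg' Hw')].
    intros P [X Y] Z; split; [split; [apply X, Z|apply Y, Z]|exact Z].
  - intros P Q HP HQ; apply key in HP; apply key in HQ.
    change (Rabs (S f Q - S f P) < eps)%R.
    apply Rabs_def2 in HP; apply Rabs_def2 in HQ; apply Rabs_def1; lra.
Qed.

(** The integrands of interest have no useful value at 0 and 1. Clipping the argument to [d, 1 - d]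
    gives a function continuous everywhere, which differs from [f] only on two end pieces of length
    [d], and there by at most 2 * M. *)
Lemma ex_RInt_bounded_continuous (f : R -> R) (M : R) :
  (forall x, (0 < x < 1)%R -> continuous f x) ->
  (forall x, (0 < x < 1)%R -> (Rabs (f x) <= M)%R) ->
  ex_RInt f 0 1.
Proof.
  intros Hc Hb.
  assert (HM : (0 <= M)%R).
  { eapply Rle_trans; [apply Rabs_pos|apply (Hb (1/2)%R); lra]. }
  set (clip := fun d x => Rmax d (Rmin x (1 - d))).
  (* Nothing is known about [f] at 0 and 1, so it is replaced by 0 there; this makes the bound [M]
     valid everywhere. *)
  set (f0 := fun x => if Rlt_dec 0 x then if Rlt_dec x 1 then f x else 0%R else 0%R).
  assert (Hf0 : forall x, (0 < x < 1)%R -> f0 x = f x).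
  { intros x Hx; unfold f0; destruct Rlt_dec; [|lra]; destruct Rlt_dec; [easy|lra]. }
  assert (Hb0 : forall x, (Rabs (f0 x) <= M)%R).
  { intros x; unfold f0; do 2 (destruct Rlt_dec; [|rewrite Rabs_R0; exact HM]).
    apply Hb; lra. }
  apply (ex_RInt_ext f0).
  { rewrite Rmin_left, Rmax_right by lra; exact Hf0. }
  apply ex_RInt_approx; [lra|]; intros eps.
  (* The error function has integral 4 * M * d, less than [eps] for this [d]; the bound 1/4 keeps d
     < 1 - d. *)
  set (d := Rmin (1/4) (eps / (8 * (M + 1)))).
  assert (Hd : (0 < d)%R).
  { apply Rmin_pos; [lra|]; apply Rdiv_lt_0_compat; [apply eps|lra]. }
  assert (Hd4 : (d <= 1/4)%R) by apply Rmin_l.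
  assert (HdM : (d * (8 * (M + 1)) <= eps)%R).
  { apply (Rmult_le_reg_r (/ (8 * (M + 1)))); [apply Rinv_0_lt_compat; lra|].
    replace (d * (8 * (M + 1)) * / (8 * (M + 1)))%R with d by (field; lra).
    apply Rmin_r. }
  exists (fun x => f (clip d x)),
    (fun x => if Rle_dec x d then (2 * M)%R
       else if Rle_dec (1 - d) x then (2 * M)%R else 0%R),
    (d * (2 * M) + (1 - 2 * d) * 0 + d * (2 * M))%R.
  split; [|split; [|split]].
  - apply (ex_RInt_continuous (V := R_CompleteNormedModule)); intros x _.
    apply (continuous_comp (clip d) f).
    + unfold clip.
      apply (continuous_comp_2 (fun _ => d) (fun x => Rmin x (1 - d)) Rmax).
      * apply continuous_const.
      * apply (continuous_comp_2 (fun x => x) (fun _ => 1 - d)%R Rmin);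
          [apply continuous_id|apply continuous_const|].
        apply continuity_2d_pt_filterlim; intros e; exists e; intros u v Hu Hv.
        unfold Rmin; simpl.
        destruct e as [e He]; simpl in *.
        apply Rabs_def2 in Hu; apply Rabs_def2 in Hv.
        do 2 destruct Rle_dec; apply Rabs_def1; lra.
      * apply continuity_2d_pt_filterlim; intros e; exists e; intros u v Hu Hv.
        unfold Rmax; simpl.
        destruct e as [e He]; simpl in *.
        apply Rabs_def2 in Hu; apply Rabs_def2 in Hv.
        do 2 destruct Rle_dec; apply Rabs_def1; lra.
    + apply Hc; unfold clip, Rmax, Rmin; repeat destruct Rle_dec; lra.
  - apply (is_RInt_Chasles (V := R_NormedModule) _ 0 (1 - d) 1).
    + apply (is_RInt_Chasles (V := R_NormedModule) _ 0 d (1 - d)).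
      * apply (is_RInt_ext (fun _ => 2 * M)%R).
        { rewrite Rmin_left, Rmax_right by lra; intros x Hx.
          destruct Rle_dec; [easy|lra]. }
        replace (d * (2 * M))%R with ((d - 0) * (2 * M))%R by ring.
        apply is_RInt_Rconst.
      * apply (is_RInt_ext (fun _ => 0)%R).
        { rewrite Rmin_left, Rmax_right by lra; intros x Hx.
          destruct Rle_dec; [lra|]; destruct Rle_dec; [lra|easy]. }
        replace ((1 - 2 * d) * 0)%R with ((1 - d - d) * 0)%R by ring.
        apply is_RInt_Rconst.
    + apply (is_RInt_ext (fun _ => 2 * M)%R).
      { rewrite Rmin_left, Rmax_right by lra; intros x Hx.
        destruct Rle_dec; [easy|]; destruct Rle_dec; [easy|lra]. }
      replace (d * (2 * M))%R with ((1 - (1 - d)) * (2 * M))%R by ring.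
      apply is_RInt_Rconst.
  - nra.
  - intros x Hx.
    assert (B : (0 < clip d x < 1)%R).
    { unfold clip, Rmax, Rmin; repeat destruct Rle_dec; lra. }
    assert (B2 : (Rabs (f0 x - f (clip d x)) <= 2 * M)%R).
    { eapply Rle_trans; [apply Rabs_triang|]; rewrite Rabs_Ropp.
      assert (H1 := Hb0 x); assert (H2 := Hb _ B); lra. }
    destruct Rle_dec as [H|H]; [exact B2|].
    destruct Rle_dec as [H'|H']; [exact B2|].
    replace (clip d x) with x.
    + rewrite Hf0 by lra; rewrite Rminus_diag, Rabs_R0; lra.
    + unfold clip, Rmax, Rmin; repeat destruct Rle_dec; lra.
Qed.

Definition is_CInt (f : R -> C) (a b : R) (l : C) : Prop :=
  is_RInt (V := C_R_NormedModule) f a b l.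

Lemma is_CInt_iff (f : R -> C) (a b : R) (l : C) :
  is_CInt f a b l <->
  is_RInt (fun t => Re (f t)) a b (Re l) /\ is_RInt (fun t => Im (f t)) a b (Im l).
Proof.
  split.
  - intros H; split.
    + exact (is_RInt_fct_extend_fst (U := R_NormedModule) (V := R_NormedModule) f a b l H).
    + exact (is_RInt_fct_extend_snd (U := R_NormedModule) (V := R_NormedModule) f a b l H).
  - intros [H1 H2]; destruct l as [l1 l2].
    exact (is_RInt_fct_extend_pair (U := R_NormedModule) (V := R_NormedModule) f a b l1 l2 H1 H2).
Qed.

Lemma is_CInt_unique (f : R -> C) (a b : R) (l l' : C) :
  is_CInt f a b l -> is_CInt f a b l' -> l = l'.
Proof.
  intros H H'; apply (is_RInt_unique (V := C_R_CompleteNormedModule)) in H.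
  apply (is_RInt_unique (V := C_R_CompleteNormedModule)) in H'.
  rewrite <- H; exact H'.
Qed.

Lemma is_CInt_ext (f g : R -> C) (a b : R) (l : C) :
  (forall x, (Rmin a b < x < Rmax a b)%R -> f x = g x) ->
  is_CInt f a b l -> is_CInt g a b l.
Proof. apply (is_RInt_ext (V := C_R_NormedModule)). Qed.

Lemma is_CInt_plus (f g : R -> C) (a b : R) (lf lg : C) :
  is_CInt f a b lf -> is_CInt g a b lg ->
  is_CInt (fun x => f x + g x) a b (lf + lg).
Proof. apply (is_RInt_plus (V := C_R_NormedModule)). Qed.

Lemma is_CInt_minus (f g : R -> C) (a b : R) (lf lg : C) :
  is_CInt f a b lf -> is_CInt g a b lg ->
  is_CInt (fun x => f x - g x) a b (lf - lg).
Proof. apply (is_RInt_minus (V := C_R_NormedModule)). Qed.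

Lemma is_CInt_scal (c : C) (f : R -> C) (a b : R) (l : C) :
  is_CInt f a b l -> is_CInt (fun x => c * f x) a b (c * l).
Proof.
  intros H; apply is_CInt_iff in H; destruct H as [H1 H2]; apply is_CInt_iff; split.
  - apply (is_RInt_minus (V := R_NormedModule));
      apply (is_RInt_scal (V := R_NormedModule)); assumption.
  - apply (is_RInt_plus (V := R_NormedModule));
      apply (is_RInt_scal (V := R_NormedModule)); assumption.
Qed.

Lemma is_CInt_sum (f : nat -> R -> C) (l : nat -> C) (a b : R) (n : nat) :
  (forall k, (k <= n)%nat -> is_CInt (f k) a b (l k)) ->
  is_CInt (fun x => sum_n (fun k => f k x) n) a b (sum_n l n).
Proof.
  induction n as [|n IH]; intros H.
  - apply (is_CInt_ext (f 0%nat)); [intros; rewrite sum_O; reflexivity|].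
    rewrite sum_O; apply H; lia.
  - apply (is_CInt_ext (fun x => sum_n (fun k => f k x) n + f (S n) x)).
    + intros; rewrite sum_Sn; reflexivity.
    + rewrite sum_Sn; apply is_CInt_plus; [apply IH; intros|]; apply H; lia.
Qed.

Lemma is_CInt_bound (f : R -> C) (a b : R) (l : C) (M : R) :
  (a < b)%R -> (forall x, (a < x < b)%R -> (Cmod (f x) <= M)%R) ->
  is_CInt f a b l -> (Cmod l <= (b - a) * M)%R.
Proof.
  intros Hab HM H.
  assert (M0 : (0 <= M)%R).
  { eapply Rle_trans; [apply Cmod_ge_0|apply (HM ((a + b) / 2)%R); lra]. }
  (* The bound is assumed on the open interval only, so the end point values are set to 0. *)
  set (g := fun x => if Rlt_dec a x then if Rlt_dec x b then f x else 0 else 0).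
  rewrite Cmod_norm.
  apply (norm_RInt_le_const (V := C_R_NormedModule) g).
  - lra.
  - intros x _; rewrite <- Cmod_norm; unfold g.
    do 2 (destruct Rlt_dec; [|rewrite Cmod_0; exact M0]); apply HM; lra.
  - eapply is_CInt_ext; [|exact H].
    rewrite Rmin_left, Rmax_right by lra; intros x Hx; unfold g.
    do 2 (destruct Rlt_dec; [|lra]); reflexivity.
Qed.

Lemma ex_CInt_bounded_continuous (f : R -> C) (M : R) :
  (forall x, (0 < x < 1)%R -> Ccontinuous f x) ->
  (forall x, (0 < x < 1)%R -> (Cmod (f x) <= M)%R) ->
  exists l, is_CInt f 0 1 l.
Proof.
  intros Hc Hb.
  destruct (ex_RInt_bounded_continuous (fun x => Re (f x)) M) as [l1 H1].
  { intros; apply Hc; assumption. }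
  { intros; eapply Rle_trans; [apply re_le_Cmod|apply Hb; assumption]. }
  destruct (ex_RInt_bounded_continuous (fun x => Im (f x)) M) as [l2 H2].
  { intros; apply Hc; assumption. }
  { intros; eapply Rle_trans; [apply im_le_Cmod|apply Hb; assumption]. }
  exists (l1, l2); apply is_CInt_iff; split; assumption.
Qed.

Lemma ex_CInt_continuous (f : R -> C) (a b : R) :
  (a <= b)%R -> (forall x, (a <= x <= b)%R -> Ccontinuous f x) ->
  exists l, is_CInt f a b l.
Proof.
  intros Hab Hc.
  destruct (ex_RInt_continuous (V := R_CompleteNormedModule) (fun x => Re (f x)) a b)
    as [l1 H1].
  { rewrite Rmin_left, Rmax_right by lra; intros; apply Hc; assumption. }
  destruct (ex_RInt_continuous (V := R_CompleteNormedModule) (fun x => Im (f x)) a b)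
    as [l2 H2].
  { rewrite Rmin_left, Rmax_right by lra; intros; apply Hc; assumption. }
  exists (l1, l2); apply is_CInt_iff; split; assumption.
Qed.

Lemma is_CInt_derive (f f' : R -> C) (a b : R) :
  (a <= b)%R ->
  (forall x, (a <= x <= b)%R -> is_Cderive f x (f' x) /\ Ccontinuous f' x) ->
  is_CInt f' a b (f b - f a).
Proof.
  intros Hab H; apply is_CInt_iff; split.
  - apply (is_RInt_derive (V := R_CompleteNormedModule)
      (fun x => Re (f x)) (fun x => Re (f' x)));
      rewrite Rmin_left, Rmax_right by lra; intros; apply H; assumption.
  - apply (is_RInt_derive (V := R_CompleteNormedModule)
      (fun x => Im (f x)) (fun x => Im (f' x)));
      rewrite Rmin_left, Rmax_right by lra; intros; apply H; assumption.
Qed.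

(** * The integrand of Hermite's formula *)

(** With [q := log_quotient m] this is [stieltjes_integrand]. Keeping [q] general lets the same
    estimates serve [shifted_power t] and the remainder [power_tail n t]. *)
Definition hermite_integrand (q : C -> C) (a : C) (u : R) : C :=
  (q (a - RtoC (ln (1 - u)) / (RtoC (2 * PI) * Ci))
   - q (a + RtoC (ln (1 - u)) / (RtoC (2 * PI) * Ci))) / RtoC u.

Definition height (u : R) : R := (- ln (1 - u) / (2 * PI))%R.

Lemma two_PI_gt_2 : (2 < 2 * PI)%R.
Proof. generalize PI2_1; lra. Qed.

Lemma Ci_neq_0 : Ci <> 0.
Proof. intros H; injection H; lra. Qed.

Lemma RtoC_neq_0 (x : R) : x <> 0%R -> RtoC x <> 0.
Proof. intros H E; apply H; injection E; trivial. Qed.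

Lemma Ci_sqr : Ci * Ci = - RtoC 1.
Proof. apply C_eq; simpl; ring. Qed.

Lemma hermite_node (u : R) :
  RtoC (ln (1 - u)) / (RtoC (2 * PI) * Ci) = Ci * RtoC (height u).
Proof.
  assert (H := two_PI_gt_2).
  unfold height, Rdiv; rewrite (RtoC_mult (- _) _), RtoC_opp, RtoC_inv by lra.
  set (c := RtoC (2 * PI)); set (l := RtoC (ln (1 - u))).
  assert (Hc : c <> 0) by (apply RtoC_neq_0; lra).
  assert (Hi := Ci_neq_0).
  transitivity (- (Ci * Ci) * l / (c * Ci)); [rewrite Ci_sqr|]; field; split; assumption.
Qed.

Lemma hermite_integrand_eq (q : C -> C) (a : C) (u : R) :
  hermite_integrand q a u
  = (q (a - Ci * RtoC (height u)) - q (a + Ci * RtoC (height u))) / RtoC u.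
Proof. unfold hermite_integrand; rewrite hermite_node; reflexivity. Qed.

Lemma ln_le_minus_1 (t : R) : (0 < t)%R -> (ln t <= t - 1)%R.
Proof.
  intros Ht; generalize (exp_ineq1_le (ln t)); rewrite exp_ln by exact Ht; lra.
Qed.

Lemma height_ge_0 (u : R) : (0 <= u < 1)%R -> (0 <= height u)%R.
Proof.
  intros Hu; assert (H := ln_le_minus_1 (1 - u)); assert (P := two_PI_gt_2).
  unfold height; apply Rle_mult_inv_pos; lra.
Qed.

(** From ln x <= x - 1 at x = 1/(1-u). The point is that the height is O(u) near u = 0. *)
Lemma height_le (u : R) : (0 <= u < 1)%R -> (height u <= u / (2 * (1 - u)))%R.
Proof.
  intros Hu; assert (P := two_PI_gt_2).
  assert (H := ln_le_minus_1 (/ (1 - u))).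
  rewrite ln_Rinv in H by lra.
  assert (Hi : (0 < / (1 - u))%R) by (apply Rinv_0_lt_compat; lra).
  assert (E : (/ (1 - u) - 1 = u * / (1 - u))%R) by (field; lra).
  assert (H0 : (0 <= u * / (1 - u))%R) by (apply Rmult_le_pos; lra).
  unfold height; apply (Rmult_le_reg_r (2 * PI)); [lra|].
  replace (- ln (1 - u) / (2 * PI) * (2 * PI))%R with (- ln (1 - u))%R by (field; lra).
  replace (u / (2 * (1 - u)) * (2 * PI))%R with (PI * (u * / (1 - u)))%R by (field; lra).
  nra.
Qed.

Lemma is_derive_height (u : R) :
  (u < 1)%R -> is_derive height u (/ (2 * PI * (1 - u)))%R.
Proof.
  intros Hu; assert (P := two_PI_gt_2); unfold height.
  auto_derive; [lra|field; lra].
Qed.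

Lemma Re_plus_Ci (a : C) (y : R) : Re (a + Ci * RtoC y) = Re a.
Proof. simpl; unfold Re; ring. Qed.

Lemma Re_minus_Ci (a : C) (y : R) : Re (a - Ci * RtoC y) = Re a.
Proof. simpl; unfold Re; ring. Qed.

Lemma rhp_derive_continuous (q q' : C -> C) (p : R -> C) (t : R) (l : C) :
  is_rhp_derive q q' -> (0 < Re (p t))%R -> is_Cderive p t l ->
  Ccontinuous (fun x => q (p x)) t.
Proof. intros Hq H Hp; eapply is_Cderive_continuous, Hq; eassumption. Qed.

Lemma is_Cderive_node (a : C) (u : R) :
  (u < 1)%R ->
  is_Cderive (fun u => a + Ci * RtoC (height u)) u
    (Ci * RtoC (/ (2 * PI * (1 - u)))).
Proof.
  intros Hu; eapply is_Cderive_eq.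
  - apply is_Cderive_plus; [apply is_Cderive_const|].
    apply is_Cderive_scal, is_Cderive_RtoC, is_derive_height, Hu.
  - ring.
Qed.

Lemma is_Cderive_conj_node (a : C) (u : R) :
  (u < 1)%R ->
  is_Cderive (fun u => a - Ci * RtoC (height u)) u
    (- (Ci * RtoC (/ (2 * PI * (1 - u))))).
Proof.
  intros Hu; eapply is_Cderive_eq.
  - apply is_Cderive_minus; [apply is_Cderive_const|].
    apply is_Cderive_scal, is_Cderive_RtoC, is_derive_height, Hu.
  - ring.
Qed.

(** For u <= 1/2 the two points are 2 * [height u] <= 2 * u apart and the mean value inequality
    gives 4 * M * u. For u > 1/2 the trivial bound 2 * M is already below 4 * M * u. All points
    involved lie on the vertical line through [a]. *)
Lemma vertical_difference_bound (q q' : C -> C) (a : C) (M : R) (u : R) :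
  is_rhp_derive q q' -> (0 < Re a)%R ->
  (forall z, Re z = Re a -> (Cmod (q z) <= M)%R /\ (Cmod (q' z) <= M)%R) ->
  (0 < u < 1)%R ->
  (Cmod (q (a - Ci * RtoC (height u)) - q (a + Ci * RtoC (height u)))%C
    <= 4 * M * u)%R.
Proof.
  intros Hq Ha HM Hu.
  assert (M0 : (0 <= M)%R).
  { eapply Rle_trans; [apply Cmod_ge_0|apply (HM a eq_refl)]. }
  destruct (Rle_dec u (1/2)) as [Hu2|Hu2].
  - eapply Rle_trans.
    + apply (rhp_mean_value q q' _ _ M Hq).
      * rewrite Re_plus_Ci; exact Ha.
      * rewrite Re_minus_Ci; exact Ha.
      * intros t _; apply HM; simpl; unfold Re; ring.
    + replace (a - Ci * RtoC (height u) - (a + Ci * RtoC (height u)))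
        with (- (Ci * RtoC (2 * height u))) by (rewrite RtoC_mult; ring).
      rewrite Cmod_opp, Cmod_mult, Cmod_Ci, Cmod_R, Rmult_1_l.
      assert (H0 := height_ge_0 u); assert (H1 := height_le u).
      rewrite Rabs_pos_eq by lra.
      assert (u / (2 * (1 - u)) <= u)%R.
      { apply (Rmult_le_reg_r (2 * (1 - u))); [lra|].
        replace (u / (2 * (1 - u)) * (2 * (1 - u)))%R with u by (field; lra); nra. }
      nra.
  - unfold Cminus at 1; eapply Rle_trans; [apply Cmod_triangle|]; rewrite Cmod_opp.
    destruct (HM (a - Ci * RtoC (height u)) (Re_minus_Ci _ _)) as [H1 _].
    destruct (HM (a + Ci * RtoC (height u)) (Re_plus_Ci _ _)) as [H2 _].
    nra.
Qed.

Lemma hermite_integrand_bound (q q' : C -> C) (a : C) (M : R) (u : R) :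
  is_rhp_derive q q' -> (0 < Re a)%R ->
  (forall z, Re z = Re a -> (Cmod (q z) <= M)%R /\ (Cmod (q' z) <= M)%R) ->
  (0 < u < 1)%R -> (Cmod (hermite_integrand q a u) <= 4 * M)%R.
Proof.
  intros Hq Ha HM Hu; rewrite hermite_integrand_eq.
  rewrite Cmod_div by (apply RtoC_neq_0; lra).
  rewrite (Cmod_R u), Rabs_pos_eq by lra.
  apply (Rmult_le_reg_r u); [lra|].
  unfold Rdiv; rewrite Rmult_assoc, Rinv_l, Rmult_1_r by lra.
  eapply vertical_difference_bound; eassumption.
Qed.

Lemma hermite_integrand_continuous (q q' : C -> C) (a : C) (u : R) :
  is_rhp_derive q q' -> (0 < Re a)%R -> (0 < u < 1)%R ->
  Ccontinuous (hermite_integrand q a) u.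
Proof.
  intros Hq Ha Hu.
  apply (Ccontinuous_ext_loc (fun u =>
    (q (a - Ci * RtoC (height u)) - q (a + Ci * RtoC (height u))) / RtoC u)).
  { apply filter_forall; intros; symmetry; apply hermite_integrand_eq. }
  apply Ccontinuous_div.
  - apply RtoC_neq_0; lra.
  - apply Ccontinuous_minus; (eapply rhp_derive_continuous; [exact Hq| |]).
    + rewrite Re_minus_Ci; exact Ha.
    + apply is_Cderive_conj_node; lra.
    + rewrite Re_plus_Ci; exact Ha.
    + apply is_Cderive_node; lra.
  - apply Ccontinuous_RtoC, continuous_id.
Qed.

Lemma hermite_integral_exists (q q' : C -> C) (a : C) (M : R) :
  is_rhp_derive q q' -> (0 < Re a)%R ->
  (forall z, Re z = Re a -> (Cmod (q z) <= M)%R /\ (Cmod (q' z) <= M)%R) ->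
  exists l, is_CInt (hermite_integrand q a) 0 1 l.
Proof.
  intros Hq Ha HM; apply (ex_CInt_bounded_continuous _ (4 * M)).
  - intros; eapply hermite_integrand_continuous; eassumption.
  - intros; eapply hermite_integrand_bound; eassumption.
Qed.

Lemma hermite_integral_bound (q q' : C -> C) (a : C) (M : R) (l : C) :
  is_rhp_derive q q' -> (0 < Re a)%R ->
  (forall z, Re z = Re a -> (Cmod (q z) <= M)%R /\ (Cmod (q' z) <= M)%R) ->
  is_CInt (hermite_integrand q a) 0 1 l -> (Cmod l <= 4 * M)%R.
Proof.
  intros Hq Ha HM Hl.
  replace (4 * M)%R with ((1 - 0) * (4 * M))%R by ring.
  eapply is_CInt_bound; [lra| |exact Hl].
  intros; eapply hermite_integrand_bound; eassumption.
Qed.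

(** * Cauchy's theorem in a half-strip *)

(** Green's theorem for a pair with A_x = B_u = c. The integral of A(x, .) over [0, d] is
    differentiated under the integral sign; its x-derivative is the integral of B_u, that is B(x, d)
    - B(x, 0), and integrating this over x in [0, 1] gives the claim. The margin [e] makes x = 0 an
    interior point. *)
Lemma green_rectangle (A B c : R -> R -> R) (e d I J : R) :
  (0 < e)%R -> (0 <= d < 1)%R ->
  (forall x u, (- e < x)%R -> (u < 1)%R ->
     is_derive (fun x => A x u) x (c x u) /\ is_derive (B x) u (c x u)
     /\ continuous (fun p : R * R => c (fst p) (snd p)) (x, u)) ->
  (forall x u, (- e < x)%R -> (u < 1)%R -> continuous (A x) u) ->
  (forall x u, (- e < x)%R -> (u < 1)%R -> continuous (fun x => B x u) x) ->
  is_RInt (fun u => A 1 u - A 0 u)%R 0 d I ->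
  is_RInt (fun x => B x d - B x 0)%R 0 1 J -> I = J.
Proof.
  intros He Hd H HA HB HI HJ.
  assert (exA : forall x, (- e < x)%R -> ex_RInt (A x) 0 d).
  { intros x Hx; apply (ex_RInt_continuous (V := R_CompleteNormedModule)).
    rewrite Rmin_left, Rmax_right by lra; intros u Hu; apply HA; lra. }
  assert (D : forall x, (- e < x)%R ->
    is_derive (fun x => RInt (A x) 0 d) x (B x d - B x 0)%R).
  { intros x Hx.
    assert (Hloc : locally x (fun y => - e < y)%R) by (apply open_gt; exact Hx).
    replace (B x d - B x 0)%R with (RInt (fun u => Derive (fun x => A x u) x) 0 d).
    - apply (is_derive_RInt_param A 0 d x).
      + eapply filter_imp; [|exact Hloc]; intros y Hy t Ht.
        rewrite Rmin_left, Rmax_right in Ht by lra.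
        exists (c y t); apply (H y t); lra.
      + rewrite Rmin_left, Rmax_right by lra; intros t Ht.
        apply (continuity_2d_pt_ext_loc c).
        * assert (He' : (0 < Rmin (x + e) (1 - t))%R) by (apply Rmin_pos; lra).
          exists (mkposreal _ He'); simpl; intros u v Hu Hv.
          apply Rabs_def2 in Hu; apply Rabs_def2 in Hv.
          assert (H1 := Rmin_l (x + e) (1 - t)); assert (H2 := Rmin_r (x + e) (1 - t)).
          symmetry; apply is_derive_unique, H; lra.
        * apply continuity_2d_pt_filterlim, (H x t); lra.
      + eapply filter_imp; [|exact Hloc]; intros y Hy; apply exA, Hy.
    - apply is_RInt_unique, (is_RInt_ext (c x)).
      { rewrite Rmin_left, Rmax_right by lra; intros u Hu.
        symmetry; apply is_derive_unique, H; lra. }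
      apply (is_RInt_derive (V := R_CompleteNormedModule) (B x) (c x));
        rewrite Rmin_left, Rmax_right by lra; intros u Hu.
      + apply H; lra.
      + apply (continuous_comp_2 (fun _ : R => x) (fun u : R => u) c).
        * apply continuous_const.
        * apply continuous_id.
        * apply H; lra. }
  assert (HJ' : is_RInt (fun x => B x d - B x 0)%R 0 1 (RInt (A 1%R) 0 d - RInt (A 0%R) 0 d)%R).
  { apply (is_RInt_derive (V := R_CompleteNormedModule)
      (fun x => RInt (A x) 0 d) (fun x => B x d - B x 0)%R);
      rewrite Rmin_left, Rmax_right by lra; intros x Hx.
    - apply D; lra.
    - apply continuous_Rminus; apply HB; lra. }
  assert (HI' : is_RInt (fun u => A 1 u - A 0 u)%R 0 d (RInt (A 1%R) 0 d - RInt (A 0%R) 0 d)%R).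
  { apply (is_RInt_minus (V := R_NormedModule));
      apply (RInt_correct (V := R_CompleteNormedModule)), exA; lra. }
  rewrite <- (is_RInt_unique (V := R_CompleteNormedModule) _ _ _ _ HI).
  rewrite <- (is_RInt_unique (V := R_CompleteNormedModule) _ _ _ _ HJ).
  rewrite (is_RInt_unique (V := R_CompleteNormedModule) _ _ _ _ HI').
  symmetry; apply (is_RInt_unique (V := R_CompleteNormedModule)), HJ'.
Qed.

Lemma Cgreen_rectangle (A B c : R -> R -> C) (e d : R) (I J : C) :
  (0 < e)%R -> (0 <= d < 1)%R ->
  (forall x u, (- e < x)%R -> (u < 1)%R ->
     is_Cderive (fun x => A x u) x (c x u) /\ is_Cderive (B x) u (c x u)
     /\ Ccontinuous (fun p : R * R => c (fst p) (snd p)) (x, u)) ->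
  (forall x u, (- e < x)%R -> (u < 1)%R -> Ccontinuous (A x) u) ->
  (forall x u, (- e < x)%R -> (u < 1)%R -> Ccontinuous (fun x => B x u) x) ->
  is_CInt (fun u => A 1%R u - A 0%R u) 0 d I ->
  is_CInt (fun x => B x d - B x 0%R) 0 1 J -> I = J.
Proof.
  intros He Hd H HA HB HI HJ.
  apply is_CInt_iff in HI; apply is_CInt_iff in HJ; apply C_eq.
  - apply (green_rectangle (fun x u => Re (A x u)) (fun x u => Re (B x u))
      (fun x u => Re (c x u)) e d); try assumption.
    + intros x u Hx Hu; destruct (H x u Hx Hu) as [[? ?] [[? ?] [? ?]]].
      split; [assumption|split; assumption].
    + intros; apply HA; assumption.
    + intros; apply HB; assumption.
    + apply HI.
    + apply HJ.
  - apply (green_rectangle (fun x u => Im (A x u)) (fun x u => Im (B x u))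
      (fun x u => Im (c x u)) e d); try assumption.
    + intros x u Hx Hu; destruct (H x u Hx Hu) as [[? ?] [[? ?] [? ?]]].
      split; [assumption|split; assumption].
    + intros; apply HA; assumption.
    + intros; apply HB; assumption.
    + apply HI.
    + apply HJ.
Qed.

Definition node (a sg : C) (x u : R) : C := a + RtoC x + Ci * sg * RtoC (height u).

Lemma Re_node (a : C) (s x u : R) : Re (node a (RtoC s) x u) = (Re a + x)%R.
Proof. unfold node; simpl; unfold Re; ring. Qed.

(* Cauchy's theorem for the half-strip 0 <= Re (z - a) <= 1 lying above (s = 1)
   or below (s = -1) its base, the height being parametrized by
   u = 1 - exp (- 2 pi y). *)
Lemma half_strip_contour (Phi Phi' : C -> C) (a : C) (s M : R) (J : C) :
  is_rhp_derive Phi Phi' -> rhp_continuous Phi' -> (0 < Re a)%R ->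
  (s * s = 1)%R ->
  (forall x u, (0 <= x <= 1)%R -> (0 <= u < 1)%R ->
     (Cmod (Phi (node a (RtoC s) x u)) <= M * (1 - u))%R) ->
  is_CInt (fun x => Phi (a + RtoC x)) 0 1 J ->
  is_CInt (fun u => (Phi (node a (RtoC s) 1 u) - Phi (node a (RtoC s) 0 u))
                    / RtoC (1 - u)) 0 1 (RtoC (2 * PI) * Ci * RtoC s * J).
Proof.
  intros HPhi Hc Ha Hs HM HJ.
  assert (P := two_PI_gt_2).
  set (Z := node a (RtoC s)).
  (* This factor makes the pair Phi(Z)/(1-u), k * Phi(Z) fit Green's identity: the u-derivative of
     [Z] is i s / (2 pi (1-u)), and k * i s / (2 pi) = s * s = 1. *)
  set (k := - (RtoC (2 * PI) * Ci * RtoC s)).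
  assert (Zx : forall x u, is_Cderive (fun x => Z x u) x 1).
  { intros x u; eapply is_Cderive_eq; [unfold Z, node; apply is_Cderive_plus;
      [apply is_Cderive_plus; [apply is_Cderive_const|]|apply is_Cderive_const]|].
    - apply is_Cderive_RtoC, is_derive_id.
    - change (@one R_AbsRing) with 1%R; ring. }
  assert (Zu : forall x u, (u < 1)%R ->
     is_Cderive (Z x) u (Ci * RtoC s * RtoC (/ (2 * PI * (1 - u))))).
  { intros x u Hu; eapply is_Cderive_eq; [unfold Z, node; apply is_Cderive_plus|].
    - apply is_Cderive_const.
    - apply is_Cderive_scal, is_Cderive_RtoC, is_derive_height, Hu.
    - ring. }
  assert (RZ : forall x u, (- Re a < x)%R -> (0 < Re (Z x u))%R).
  { intros x u Hx; unfold Z; rewrite Re_node; lra. }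
  assert (Z0 : forall x, Z x 0%R = a + RtoC x).
  { intros x; unfold Z, node, height.
    rewrite Rminus_0_r, ln_1; replace (- 0 / (2 * PI))%R with 0%R by (field; lra); ring. }
  assert (CA : forall x u, (- Re a < x)%R -> (u < 1)%R ->
    Ccontinuous (fun u => Phi (Z x u) / RtoC (1 - u)) u).
  { intros x u Hx Hu; apply Ccontinuous_div.
    - apply RtoC_neq_0; lra.
    - eapply rhp_derive_continuous; [exact HPhi|apply RZ, Hx|apply Zu, Hu].
    - apply Ccontinuous_RtoC, continuous_Rminus;
        [apply continuous_const|apply continuous_id]. }
  assert (CB : forall x u, (- Re a < x)%R -> (u < 1)%R ->
    Ccontinuous (fun x => k * Phi (Z x u)) x).
  { intros x u Hx Hu; apply Ccontinuous_mult; [apply Ccontinuous_const|].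
    eapply rhp_derive_continuous; [exact HPhi|apply RZ, Hx|apply Zx]. }
  assert (Hk : (Cmod k <= 2 * PI)%R).
  { unfold k; rewrite Cmod_opp, !Cmod_mult, Cmod_Ci, !Cmod_R, (Rabs_pos_eq (2 * PI)) by lra.
    assert (Es : (Rabs s = 1)%R)
      by (apply Rsqr_inj; [apply Rabs_pos|lra|rewrite <- Rsqr_abs; unfold Rsqr; lra]).
    rewrite Es; lra. }
  assert (M0 : (0 <= M)%R).
  { assert (H := HM 0%R 0%R); assert (H' := Cmod_ge_0 (Phi (node a (RtoC s) 0 0))); lra. }
  assert (B : forall x u, (0 <= x <= 1)%R -> (0 <= u < 1)%R ->
    (Cmod (Phi (Z x u) / RtoC (1 - u)) <= M)%R).
  { intros x u Hx Hu; rewrite Cmod_div, Cmod_R, Rabs_pos_eq by (try apply RtoC_neq_0; lra).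
    apply (Rmult_le_reg_r (1 - u)); [lra|].
    unfold Rdiv; rewrite Rmult_assoc, Rinv_l, Rmult_1_r by lra.
    apply HM; assumption. }
  destruct (ex_CInt_bounded_continuous (fun u => Phi (Z 1%R u) / RtoC (1 - u)
    - Phi (Z 0%R u) / RtoC (1 - u)) (2 * M)) as [l Hl].
  { intros u Hu; apply Ccontinuous_minus; apply CA; lra. }
  { intros u Hu; unfold Cminus; eapply Rle_trans; [apply Cmod_triangle|].
    rewrite Cmod_opp; assert (B0 := B 0%R u); assert (B1 := B 1%R u); lra. }
  assert (E : l = - (k * J)).
  (* The strip is cut at u = 1 - d. The side at this height is at most 2 pi M d by the decay assumed
     of [Phi], and the part of the u-integral beyond it is at most 2 M d. *)
  { assert (Hsmall : forall d, (0 < d < 1)%R -> (Cmod (l + k * J) <= (2 + 2 * PI) * M * d)%R).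
    { intros d Hd.
      destruct (ex_CInt_continuous (fun u => Phi (Z 1%R u) / RtoC (1 - u)
        - Phi (Z 0%R u) / RtoC (1 - u)) 0 (1 - d)) as [I HI].
      { lra. }
      { intros u Hu; apply Ccontinuous_minus; apply CA; lra. }
      destruct (ex_CInt_continuous (fun x => k * Phi (Z x (1 - d)%R)) 0 1) as [Jd HJd].
      { lra. }
      { intros x Hx; apply CB; lra. }
      assert (G : I = Jd - k * J).
      { apply (Cgreen_rectangle (fun x u => Phi (Z x u) / RtoC (1 - u))
          (fun x u => k * Phi (Z x u)) (fun x u => Phi' (Z x u) / RtoC (1 - u))
          (Re a) (1 - d)); try assumption; try lra.
        - intros x u Hx Hu; split; [|split].
          + eapply is_Cderive_eq.
            * apply is_Cderive_mult; [apply HPhi; [apply RZ, Hx|apply Zx]|].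
              apply is_Cderive_const.
            * cbv beta; unfold Cdiv; ring.
          + eapply is_Cderive_eq.
            * apply is_Cderive_scal, HPhi; [apply RZ, Hx|apply Zu, Hu].
            * unfold k.
              replace (/ (2 * PI * (1 - u)))%R with (/ (2 * PI) * / (1 - u))%R by (field; lra).
              rewrite (RtoC_mult (/ _) (/ _)), !RtoC_inv by lra.
              set (c := RtoC (2 * PI)); set (y := RtoC (1 - u)).
              assert (c <> 0) by (apply RtoC_neq_0; lra).
              assert (y <> 0) by (apply RtoC_neq_0; lra).
              transitivity (- (Ci * Ci) * (RtoC s * RtoC s) * Phi' (Z x u) / y);
                [field; split; assumption|].
              rewrite Ci_sqr, <- RtoC_mult, Hs; field; assumption.
          + apply (Ccontinuous_div (fun p => Phi' (Z (fst p) (snd p)))).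
            * apply RtoC_neq_0; simpl; lra.
            * apply Hc; [apply RZ, Hx|].
              unfold Z, node; apply Ccontinuous_plus; [apply Ccontinuous_plus|].
              -- apply Ccontinuous_const.
              -- apply Ccontinuous_RtoC, continuous_fst.
              -- apply Ccontinuous_mult; [apply Ccontinuous_const|].
                 apply Ccontinuous_RtoC, continuous_real_comp; [|apply continuous_snd].
                 eexists; apply is_derive_height, Hu.
            * apply Ccontinuous_RtoC, continuous_Rminus;
                [apply continuous_const|apply continuous_snd].
        - apply is_CInt_minus; [exact HJd|].
          apply (is_CInt_ext (fun x => k * Phi (a + RtoC x)));
            [intros; rewrite Z0; reflexivity|].
          apply is_CInt_scal, HJ. }
      assert (HT : is_CInt (fun u => Phi (Z 1%R u) / RtoC (1 - u)
        - Phi (Z 0%R u) / RtoC (1 - u)) (1 - d) 1 (l - I)).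
      { replace (l - I) with (plus (opp I) l)
          by (change (- I + l = l - I); ring).
        apply (is_RInt_Chasles (V := C_R_NormedModule) _ _ 0); [|exact Hl].
        apply (is_RInt_swap (V := C_R_NormedModule)), HI. }
      apply (is_CInt_bound _ _ _ _ (2 * M)) in HT.
      - apply (is_CInt_bound _ _ _ _ (2 * PI * (M * d))) in HJd.
        + replace (l + k * J) with ((l - I) + Jd) by (rewrite G; ring).
          eapply Rle_trans; [apply Cmod_triangle|]; nra.
        + lra.
        + intros x Hx; rewrite Cmod_mult.
          apply Rmult_le_compat; try apply Cmod_ge_0; [exact Hk|].
          replace d with (1 - (1 - d))%R at 2 by ring; apply HM; lra.
      - lra.
      - intros u Hu; unfold Cminus; eapply Rle_trans; [apply Cmod_triangle|].
        rewrite Cmod_opp; assert (B0 := B 0%R u); assert (B1 := B 1%R u); lra. }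
    assert (Cmod (l + k * J) = 0)%R.
    { apply Rle_antisym; [|apply Cmod_ge_0].
      apply Rnot_lt_le; intros Hpos.
      set (K := ((2 + 2 * PI) * M)%R) in *.
      assert (K0 : (0 <= K)%R) by (apply Rmult_le_pos; lra).
      set (d := Rmin (1/2) (Cmod (l + k * J) / (2 * (K + 1)))).
      assert (d0 : (0 < d)%R) by (apply Rmin_pos; [lra|apply Rdiv_lt_0_compat; lra]).
      assert (d1 : (d <= 1/2)%R) by apply Rmin_l.
      assert (d2 : (d * (2 * (K + 1)) <= Cmod (l + k * J))%R).
      { apply (Rmult_le_reg_r (/ (2 * (K + 1)))); [apply Rinv_0_lt_compat; lra|].
        rewrite Rmult_assoc, Rinv_r, Rmult_1_r by lra; apply Rmin_r. }
      assert (H := Hsmall d); nra. }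
    apply Cmod_eq_0 in H.
    replace l with (l + k * J - k * J) by ring; rewrite H; ring. }
  apply (is_CInt_ext (fun u => Phi (Z 1%R u) / RtoC (1 - u) - Phi (Z 0%R u) / RtoC (1 - u))).
  { intros; unfold Cdiv, Cminus; ring. }
  replace (RtoC (2 * PI) * Ci * RtoC s * J) with l; [exact Hl|].
  rewrite E; unfold k; ring.
Qed.

(** * Fourier modes on the half-strips *)

Lemma Cexp_plus (z w : C) : Cexp (z + w) = Cexp z * Cexp w.
Proof.
  unfold Cexp; apply C_eq; simpl; unfold Re, Im; simpl;
    rewrite exp_plus, ?cos_plus, ?sin_plus; ring.
Qed.

Lemma Cexp_0 : Cexp 0 = 1.
Proof. unfold Cexp; apply C_eq; simpl; rewrite exp_0, cos_0, sin_0; ring. Qed.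

Lemma Cmod_Cexp (z : C) : Cmod (Cexp z) = exp (Re z).
Proof.
  unfold Cexp; rewrite Cmod_mult, Cmod_R, Rabs_pos_eq by apply Rlt_le, exp_pos.
  replace (Cmod (cos (Im z), sin (Im z))) with 1%R; [ring|].
  unfold Cmod; simpl.
  replace (cos (Im z) * (cos (Im z) * 1) + sin (Im z) * (sin (Im z) * 1))%R
    with ((sin (Im z))² + (cos (Im z))²)%R by (unfold Rsqr; ring).
  rewrite sin2_cos2, sqrt_1; reflexivity.
Qed.

Lemma is_CInt_bound_fun (f : R -> C) (g : R -> R) (a b : R) (l : C) (lg : R) :
  (a <= b)%R -> (forall x, (a < x < b)%R -> (Cmod (f x) <= g x)%R) ->
  is_CInt f a b l -> is_RInt g a b lg -> (Cmod l <= lg)%R.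
Proof.
  intros Hab HM H Hg.
  set (T := fun x => if Rlt_dec a x then if Rlt_dec x b then true else false else false).
  assert (HT : forall x, (Rmin a b < x < Rmax a b)%R -> T x = true).
  { rewrite Rmin_left, Rmax_right by lra; intros x Hx; unfold T.
    do 2 (destruct Rlt_dec; [|lra]); reflexivity. }
  rewrite Cmod_norm.
  apply (norm_RInt_le (V := C_R_NormedModule) (fun x => if T x then f x else RtoC 0)
    (fun x => if T x then g x else 0%R) a b).
  - exact Hab.
  - intros x _; rewrite <- Cmod_norm; unfold T.
    do 2 (destruct Rlt_dec; [|rewrite Cmod_0; lra]); apply HM; lra.
  - eapply is_CInt_ext; [|exact H]; intros x Hx; rewrite HT by exact Hx; reflexivity.
  - eapply is_RInt_ext; [|exact Hg]; intros x Hx; rewrite HT by exact Hx; reflexivity.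
Qed.

Definition mode (s : R) (k : nat) : C := Ci * RtoC (2 * PI * s * INR k).

(** The sign [s] of the frequency is that of the half-strip, so the exponential decays away from the
    base: exp(2 pi i s k * i s y) = exp(-2 pi k y) = (1-u)^k. *)
Lemma Cexp_mode_node (a : C) (s x u : R) (k : nat) :
  (s * s = 1)%R -> (u < 1)%R ->
  Cexp (mode s k * (node a (RtoC s) x u - a))
  = RtoC ((1 - u) ^ k) * Cexp (mode s k * RtoC x).
Proof.
  intros Hs Hu; assert (P := two_PI_gt_2).
  replace (mode s k * (node a (RtoC s) x u - a))
    with (RtoC (INR k * ln (1 - u)) + mode s k * RtoC x).
  - rewrite Cexp_plus; f_equal.
    assert (E : exp (INR k * ln (1 - u)) = ((1 - u) ^ k)%R)
      by (rewrite <- (Rpower_pow k (1 - u)) by lra; reflexivity).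
    unfold Cexp; cbn [Re Im RtoC fst snd]; rewrite E, cos_0, sin_0.
    apply C_eq; cbn [Re Im RtoC fst snd Cmult]; ring.
  - unfold node, mode, height.
    replace (INR k * ln (1 - u))%R
      with (- (s * s) * (2 * PI * INR k) * (- ln (1 - u) / (2 * PI)))%R
      by (rewrite Hs; field; lra).
    rewrite !RtoC_mult, RtoC_opp, RtoC_mult.
    set (c := RtoC (- ln (1 - u) / (2 * PI))).
    transitivity (Ci * Ci * (RtoC s * RtoC s) * (RtoC 2 * RtoC PI * RtoC (INR k)) * c
      + Ci * (RtoC 2 * RtoC PI * RtoC s * RtoC (INR k)) * RtoC x);
      [rewrite Ci_sqr|]; ring.
Qed.

Lemma Cexp_mode_1 (s : R) (k : nat) : (s * s = 1)%R -> Cexp (mode s k * RtoC 1) = 1.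
Proof.
  intros Hs.
  assert (H : (s = 1 \/ s = -1)%R).
  { assert (E : ((s - 1) * (s + 1) = 0)%R) by lra.
    apply Rmult_integral in E; lra. }
  assert (C1 : cos (2 * PI * INR k) = 1%R).
  { replace (2 * PI * INR k)%R with (0 + 2 * INR k * PI)%R by ring.
    rewrite cos_period; apply cos_0. }
  assert (S1 : sin (2 * PI * INR k) = 0%R).
  { replace (2 * PI * INR k)%R with (0 + 2 * INR k * PI)%R by ring.
    rewrite sin_period; apply sin_0. }
  assert (E : mode s k * RtoC 1 = (0%R, (s * (2 * PI * INR k))%R)).
  { unfold mode; apply C_eq; simpl; ring. }
  rewrite E; unfold Cexp; cbn [Re Im fst snd].
  destruct H as [-> | ->].
  - rewrite Rmult_1_l, exp_0, C1, S1; apply C_eq; simpl; ring.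
  - replace (-1 * (2 * PI * INR k))%R with (- (2 * PI * INR k))%R by ring.
    rewrite exp_0, cos_neg, sin_neg, C1, S1; apply C_eq; simpl; ring.
Qed.

Lemma Cmod_Cexp_mode (s x : R) (k : nat) : Cmod (Cexp (mode s k * RtoC x)) = 1%R.
Proof.
  rewrite Cmod_Cexp.
  replace (Re (mode s k * RtoC x)) with 0%R; [apply exp_0|].
  unfold mode; simpl; ring.
Qed.

(** [half_strip_contour] for Phi(z) = f(z) exp(2 pi i s (j+1) (z - a)). The exponential takes the
    same values on both vertical sides, by periodicity. One of its j + 1 factors 1 - u gives the
    decay required there and cancels the denominator 1 - u, which leaves the exponent [j]. *)
Lemma fourier_mode (f f' : C -> C) (a : C) (s M : R) (j : nat) (J : C) :
  is_rhp_derive f f' -> rhp_continuous f -> rhp_continuous f' -> (0 < Re a)%R ->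
  (s * s = 1)%R ->
  (forall z, (Re a <= Re z)%R -> (Cmod (f z) <= M)%R) ->
  is_CInt (fun x => f (a + RtoC x) * Cexp (mode s (S j) * RtoC x)) 0 1 J ->
  is_CInt (fun u => (f (node a (RtoC s) 1 u) - f (node a (RtoC s) 0 u))
                    * RtoC ((1 - u) ^ j)) 0 1 (RtoC (2 * PI) * Ci * RtoC s * J).
Proof.
  intros Hf Cf Cf' Ha Hs HM HJ.
  set (e := fun z => Cexp (mode s (S j) * (z - a))).
  eapply is_CInt_ext;
    [|apply (half_strip_contour (fun z => f z * e z)
        (fun z => f' z * e z + f z * (mode s (S j) * e z)) a s M J)];
    try assumption.
  - rewrite Rmin_left, Rmax_right by lra; intros u Hu; cbv beta; unfold e.
    rewrite !Cexp_mode_node by lra.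
    rewrite Cexp_mode_1 by exact Hs.
    replace (mode s (S j) * RtoC 0) with (RtoC 0) by ring.
    rewrite Cexp_0; simpl pow; rewrite RtoC_mult; field.
    apply RtoC_neq_0; lra.
  - intros p t l Hp Hl; eapply is_Cderive_eq.
    + apply is_Cderive_mult; [apply Hf; eassumption|].
      apply is_Cderive_Cexp, is_Cderive_scal, is_Cderive_minus;
        [exact Hl|apply is_Cderive_const].
    + cbv beta; fold (e (p t)); unfold e; ring.
  - intros U p x Hp Hl.
    assert (He : Ccontinuous (fun y => e (p y)) x).
    { apply Ccontinuous_Cexp, Ccontinuous_mult; [apply Ccontinuous_const|].
      apply Ccontinuous_minus; [exact Hl|apply Ccontinuous_const]. }
    apply Ccontinuous_plus; apply Ccontinuous_mult.
    + apply Cf'; assumption.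
    + exact He.
    + apply Cf; assumption.
    + apply Ccontinuous_mult; [apply Ccontinuous_const|exact He].
  - intros x u Hx Hu; unfold e.
    rewrite Cexp_mode_node, !Cmod_mult, Cmod_Cexp_mode, Cmod_R by lra.
    rewrite Rabs_pos_eq by (apply pow_le; lra).
    rewrite Rmult_1_r; apply Rmult_le_compat.
    + apply Cmod_ge_0.
    + apply pow_le; lra.
    + apply HM; rewrite Re_node; lra.
    + simpl.
      assert (H1 : ((1 - u) ^ j <= 1 ^ j)%R) by (apply pow_incr; lra).
      rewrite pow1 in H1.
      assert (H0 : (0 <= (1 - u) ^ j)%R) by (apply pow_le; lra).
      nra.
  - eapply is_CInt_ext; [|exact HJ]; intros x _; cbv beta; unfold e.
    do 3 f_equal; ring.
Qed.

Lemma RtoC_m1 : RtoC (-1) = - RtoC 1.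
Proof. rewrite <- RtoC_opp; reflexivity. Qed.

(** The lower half-strip is subtracted from the upper one. The four values of [f] then group into
    the difference of the Hermite integrands at [a] and [a + 1], each times u; the sign s = -1 turns
    the difference of contour values into a sum, so the two exponentials add up to a cosine. *)
Lemma fourier_mode_cos (f f' : C -> C) (a : C) (M : R) (j : nat) :
  is_rhp_derive f f' -> rhp_continuous f -> rhp_continuous f' -> (0 < Re a)%R ->
  (forall z, (Re a <= Re z)%R -> (Cmod (f z) <= M)%R) ->
  exists J : C,
  is_CInt (fun x => f (a + RtoC x) * RtoC (2 * cos (2 * PI * INR (S j) * x))) 0 1 J /\
  is_CInt (fun u => (hermite_integrand f a u - hermite_integrand f (a + RtoC 1) u)
                    * RtoC (u * (1 - u) ^ j)) 0 1 (RtoC (2 * PI) * Ci * J).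
Proof.
  intros Hf Cf Cf' Ha HM.
  assert (ex : forall s, exists J,
    is_CInt (fun x => f (a + RtoC x) * Cexp (mode s (S j) * RtoC x)) 0 1 J).
  { intros s; apply ex_CInt_continuous; [lra|]; intros x Hx; apply Ccontinuous_mult.
    - apply Cf; [simpl; unfold Re in *; lra|].
      apply Ccontinuous_plus; [apply Ccontinuous_const|].
      apply Ccontinuous_RtoC, continuous_id.
    - apply Ccontinuous_Cexp, Ccontinuous_mult; [apply Ccontinuous_const|].
      apply Ccontinuous_RtoC, continuous_id. }
  destruct (ex 1%R) as [J1 H1]; destruct (ex (-1)%R) as [J2 H2].
  exists (J1 + J2); split.
  - eapply is_CInt_ext; [|apply is_CInt_plus; [exact H1|exact H2]].
    intros x _; cbv beta; rewrite <- Cmult_plus_distr_l; f_equal.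
    assert (E : forall s, mode s (S j) * RtoC x = (0%R, (s * (2 * PI * INR (S j) * x))%R)).
    { intros s; unfold mode; apply C_eq; cbn [Re Im fst snd Ci RtoC Cmult]; ring. }
    rewrite !E; unfold Cexp; cbn [Re Im fst snd].
    rewrite exp_0, Rmult_1_l.
    replace (-1 * (2 * PI * INR (S j) * x))%R with (- (2 * PI * INR (S j) * x))%R by ring.
    rewrite cos_neg, sin_neg; apply C_eq; cbn [Re Im fst snd RtoC Cmult Cplus]; ring.
  - assert (G1 := fourier_mode f f' a 1 M j J1 Hf Cf Cf' Ha ltac:(ring) HM H1).
    assert (G2 := fourier_mode f f' a (-1) M j J2 Hf Cf Cf' Ha ltac:(ring) HM H2).
    replace (RtoC (2 * PI) * Ci * (J1 + J2))
      with (RtoC (2 * PI) * Ci * RtoC 1 * J1 - RtoC (2 * PI) * Ci * RtoC (-1) * J2)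
      by (rewrite RtoC_m1; ring).
    eapply is_CInt_ext; [|apply is_CInt_minus; [exact G1|exact G2]].
    rewrite Rmin_left, Rmax_right by lra; intros u Hu; cbv beta.
    rewrite !hermite_integrand_eq, RtoC_mult.
    assert (N : forall b, node a (RtoC 1) b u = a + RtoC b + Ci * RtoC (height u))
      by (intros; unfold node; ring).
    assert (N' : forall b, node a (RtoC (-1)) b u = a + RtoC b - Ci * RtoC (height u))
      by (intros; unfold node; rewrite RtoC_m1; ring).
    rewrite !N, !N'.
    replace (a + RtoC 0) with a by ring.
    assert (RtoC u <> 0) by (apply RtoC_neq_0; lra).
    field; assumption.
Qed.

(** * Convergence of a Fourier series at the end points *)

Section DirichletKernel.
Local Open Scope R_scope.

(** The Dirichlet kernel of order N + 1 without its constant term 1. *)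
Definition cosine_kernel (N : nat) (x : R) : R :=
  sum_n (fun j => 2 * cos (2 * PI * INR (S j) * x)) N.

(** The product formula for sines makes the sum telescope. The factor sin(pi x) is kept on the left
    because it vanishes at both end points. *)
Lemma cosine_kernel_sin (N : nat) (x : R) :
  sin (PI * x) * (1 + cosine_kernel N x) = sin (INR (2 * N + 3) * PI * x).
Proof.
  assert (H : forall k, sin (PI * x) * (2 * cos (2 * PI * INR (S k) * x))
    = sin (INR (2 * k + 3) * PI * x) - sin (INR (2 * k + 1) * PI * x)).
  { intros k.
    replace (INR (2 * k + 3) * PI * x) with (2 * PI * INR (S k) * x + PI * x)
      by (rewrite plus_INR, mult_INR, S_INR; simpl; ring).
    replace (INR (2 * k + 1) * PI * x) with (2 * PI * INR (S k) * x - PI * x)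
      by (rewrite plus_INR, mult_INR, S_INR; simpl; ring).
    rewrite sin_plus, sin_minus; ring. }
  unfold cosine_kernel; induction N as [|N IH].
  - rewrite sum_O, Rmult_plus_distr_l, (H 0%nat); simpl INR.
    rewrite Rmult_1_r, Rmult_1_l; ring.
  - rewrite sum_Sn; change (@plus R_NormedModule) with Rplus.
    rewrite <- Rplus_assoc, Rmult_plus_distr_l, IH, H.
    replace (2 * S N + 1)%nat with (2 * N + 3)%nat by lia; ring.
Qed.

Lemma sin_PI_lower (x : R) : 0 <= x <= 1 -> Rmin x (1 - x) <= sin (PI * x).
Proof.
  assert (P : 2 < PI) by (generalize PI2_1; lra).
  assert (Hhalf : forall y, 0 <= y <= 1/2 -> y <= sin (PI * y)).
  (* Up to 1/3, cos >= 1/2 on [0, pi y] gives sin(pi y) >= pi y / 2 >= y; from 1/3 to 1/2, sin(pi y)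
     >= sin(pi/6) = 1/2 >= y. *)
  { intros y Hy; destruct (Rle_dec y (1/3)) as [H3|H3].
    - destruct (MVT_gen sin 0 (PI * y) cos) as (c & Hc & E).
      + intros; apply is_derive_Reals, derivable_pt_lim_sin.
      + intros; apply derivable_continuous_pt, derivable_pt_sin.
      + rewrite Rmin_left, Rmax_right in Hc by nra.
        rewrite sin_0 in E.
        assert (1 / 2 <= cos c).
        { rewrite <- cos_PI3; apply cos_decr_1; nra. }
        nra.
    - apply Rle_trans with (sin (PI / 6)).
      + rewrite sin_PI6; lra.
      + apply sin_incr_1; nra. }
  intros Hx; destruct (Rle_dec x (1/2)).
  - eapply Rle_trans; [apply Rmin_l|apply Hhalf; lra].
  - eapply Rle_trans; [apply Rmin_r|].
    replace (PI * x) with (PI - PI * (1 - x)) by ring.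
    rewrite sin_PI_x; apply Hhalf; lra.
Qed.

Lemma is_RInt_le_const (f : R -> R) (a b l M : R) :
  a <= b -> (forall x, a <= x <= b -> Rabs (f x) <= M) ->
  is_RInt f a b l -> Rabs l <= (b - a) * M.
Proof. apply (norm_RInt_le_const (V := R_NormedModule)). Qed.

(** Over a full period the sine in the antiderivative vanishes at both ends and the cosine takes
    equal values there. Hence subtracting a linear function changes no integral against the
    kernel. *)
Lemma linear_mode_integral (A B : R) (k : nat) :
  is_RInt (fun x => (A + B * x) * (2 * cos (2 * PI * INR (S k) * x))) 0 1 0.
Proof.
  assert (P := two_PI_gt_2).
  set (w := 2 * PI * INR (S k)).
  assert (Hw : 0 < w) by (apply Rmult_lt_0_compat; [lra|apply lt_0_INR; lia]).
  set (F := fun x => (A + B * x) * (2 / w) * sin (w * x) + B * (2 / (w * w)) * cos (w * x)).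
  assert (E : F 1 - F 0 = 0).
  { assert (Sw : sin w = 0).
    { replace w with (0 + 2 * INR (S k) * PI) by (unfold w; ring).
      rewrite sin_period; apply sin_0. }
    assert (Cw : cos w = 1).
    { replace w with (0 + 2 * INR (S k) * PI) by (unfold w; ring).
      rewrite cos_period; apply cos_0. }
    unfold F; rewrite !(Rmult_1_r w), !(Rmult_0_r w), Sw, Cw, sin_0, cos_0; ring. }
  assert (X : is_RInt (fun x => (A + B * x) * (2 * cos (w * x))) 0 1 (F 1 - F 0)).
  { apply (is_RInt_derive (V := R_CompleteNormedModule) F); intros x _.
    - unfold F; auto_derive; [trivial|field; lra].
    - apply (ex_derive_continuous (V := R_NormedModule)); auto_derive; trivial. }
  rewrite E in X; exact X.
Qed.

Lemma linear_kernel_integral (A B : R) (N : nat) :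
  is_RInt (fun x => (A + B * x) * cosine_kernel N x) 0 1 0.
Proof.
  unfold cosine_kernel; induction N as [|N IH].
  - eapply is_RInt_ext; [|apply (linear_mode_integral A B 0)].
    intros; rewrite sum_O; reflexivity.
  - apply (is_RInt_ext (fun x =>
      (A + B * x) * sum_n (fun j => 2 * cos (2 * PI * INR (S j) * x)) N
      + (A + B * x) * (2 * cos (2 * PI * INR (S (S N)) * x)))).
    + intros; rewrite sum_Sn; symmetry; apply Rmult_plus_distr_l.
    + assert (X := is_RInt_plus (V := R_NormedModule) _ _ _ _ _ _
        IH (linear_mode_integral A B (S N))).
      rewrite <- (Rplus_0_r 0) at 2; exact X.
Qed.

Lemma continuous_cosine_kernel (N : nat) (x : R) : continuous (cosine_kernel N) x.
Proof.
  unfold cosine_kernel; induction N as [|N IH].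
  - apply (continuous_ext (fun x => 2 * cos (2 * PI * INR 1 * x)));
      [intros; rewrite sum_O; reflexivity|].
    apply (ex_derive_continuous (V := R_NormedModule)); auto_derive; trivial.
  - apply (continuous_ext (fun x =>
      sum_n (fun j => 2 * cos (2 * PI * INR (S j) * x)) N
      + 2 * cos (2 * PI * INR (S (S N)) * x)));
      [intros; rewrite sum_Sn; reflexivity|].
    apply continuous_Rplus; [exact IH|].
    apply (ex_derive_continuous (V := R_NormedModule)); auto_derive; trivial.
Qed.

(** * Functions vanishing at both ends, integrated against the Dirichlet kernel *)

Section VanishingEnds.
Variables (h h' : R -> R) (K : R).
Hypothesis Hh : forall x, 0 <= x <= 1 -> is_derive h x (h' x) /\ continuous h' x.
Hypothesis HK : forall x, 0 <= x <= 1 -> Rabs (h' x) <= K.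
Hypothesis H0 : h 0 = 0.
Hypothesis H1 : h 1 = 0.

Lemma vanishing_ends_bound (x : R) :
  0 <= x <= 1 -> Rabs (h x) <= K * Rmin x (1 - x).
Proof.
  intros Hx.
  assert (B1 : Rabs (h x) <= K * x).
  { replace (h x) with (h x - h 0) by (rewrite H0; ring).
    replace (K * x) with (K * (x - 0)) by ring.
    apply (Rabs_mean_value h h'); [lra|].
    intros y Hy; split; [apply Hh|apply HK]; lra. }
  assert (B2 : Rabs (h x) <= K * (1 - x)).
  { rewrite <- Rabs_Ropp; replace (- h x) with (h 1 - h x) by (rewrite H1; ring).
    apply (Rabs_mean_value h h'); [lra|].
    intros y Hy; split; [apply Hh|apply HK]; lra. }
  unfold Rmin; destruct Rle_dec; assumption.
Qed.

(** The zeros of [h] at 0 and 1 cancel those of sin(pi x): |h| <= K * min(x, 1-x) <= K * sin(pi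
    x). *)
Lemma vanishing_ends_quotient_bound (x : R) :
  0 < x < 1 -> Rabs (h x / sin (PI * x)) <= K.
Proof.
  intros Hx; assert (B := vanishing_ends_bound x).
  assert (S := sin_PI_lower x).
  assert (M0 : 0 < Rmin x (1 - x)) by (apply Rmin_pos; lra).
  assert (K0 : 0 <= K) by (eapply Rle_trans; [apply Rabs_pos|apply (HK x); lra]).
  unfold Rdiv; rewrite Rabs_mult, Rabs_inv, (Rabs_pos_eq (sin _)) by lra.
  apply (Rmult_le_reg_r (sin (PI * x))); [lra|].
  rewrite Rmult_assoc, Rinv_l, Rmult_1_r by lra.
  nra.
Qed.

(** Uniform in [N], although the kernel itself has size of order N at the end points. *)
Lemma vanishing_ends_kernel_bound (N : nat) (x : R) :
  0 <= x <= 1 -> Rabs (h x * (1 + cosine_kernel N x)) <= K.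
Proof.
  intros Hx.
  assert (K0 : 0 <= K) by (eapply Rle_trans; [apply Rabs_pos|apply (HK x); lra]).
  destruct (Req_dec x 0) as [->|N0]; [rewrite H0, Rmult_0_l, Rabs_R0; exact K0|].
  destruct (Req_dec x 1) as [->|N1]; [rewrite H1, Rmult_0_l, Rabs_R0; exact K0|].
  assert (S := sin_PI_lower x).
  assert (M0 : 0 < Rmin x (1 - x)) by (apply Rmin_pos; lra).
  replace (h x * (1 + cosine_kernel N x))
    with (h x / sin (PI * x) * sin (INR (2 * N + 3) * PI * x))
    by (rewrite <- cosine_kernel_sin; field; lra).
  rewrite Rabs_mult, <- (Rmult_1_r K).
  apply Rmult_le_compat; try apply Rabs_pos.
  - apply vanishing_ends_quotient_bound; lra.
  - apply Rabs_le, SIN_bound.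
Qed.

(* Riemann-Lebesgue: away from the end points integrate by parts, near them
   the integrand is bounded by [K]. *)
Lemma vanishing_ends_kernel_integral (N : nat) (eta l : R) :
  0 < eta < 1/2 ->
  is_RInt (fun x => h x * (1 + cosine_kernel N x)) 0 1 l ->
  Rabs l <= 2 * eta * K + (2 * K + (K / eta + K * PI / eta)) / INR (S N).
Proof.
  intros He Hl; assert (P := two_PI_gt_2).
  assert (K0 : 0 <= K) by (eapply Rle_trans; [apply Rabs_pos|apply (HK 0); lra]).
  set (G := fun x => h x * (1 + cosine_kernel N x)) in *.
  set (w := INR (2 * N + 3) * PI).
  assert (HN : 0 < INR (S N)) by (apply lt_0_INR; lia).
  assert (Hw : INR (S N) <= w).
  { unfold w.
    assert (INR (S N) <= INR (2 * N + 3)) by (apply le_INR; lia).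
    nra. }
  assert (Cont : forall x, 0 <= x <= 1 -> continuous G x).
  { intros x Hx; apply continuous_Rmult.
    - apply (ex_derive_continuous (V := R_NormedModule)); eexists; apply Hh, Hx.
    - apply continuous_Rplus; [apply continuous_const|apply continuous_cosine_kernel]. }
  assert (Hex : forall a b, 0 <= a <= b -> b <= 1 -> ex_RInt G a b).
  { intros a b Ha Hb; apply (ex_RInt_continuous (V := R_CompleteNormedModule)).
    rewrite Rmin_left, Rmax_right by lra; intros; apply Cont; lra. }
  destruct (Hex 0 eta) as [l1 Hl1]; [lra|lra|].
  destruct (Hex eta (1 - eta)) as [l2 Hl2]; [lra|lra|].
  destruct (Hex (1 - eta) 1) as [l3 Hl3]; [lra|lra|].
  assert (E : l = l1 + l2 + l3).
  { rewrite <- (is_RInt_unique (V := R_CompleteNormedModule) _ _ _ _ Hl).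
    apply (is_RInt_unique (V := R_CompleteNormedModule)).
    apply (is_RInt_Chasles (V := R_NormedModule) _ _ (1 - eta)); [|exact Hl3].
    apply (is_RInt_Chasles (V := R_NormedModule) _ _ eta); [exact Hl1|exact Hl2]. }
  assert (B1 : Rabs l1 <= eta * K).
  { replace (eta * K) with ((eta - 0) * K) by ring.
    eapply is_RInt_le_const; [lra| |exact Hl1].
    intros; apply vanishing_ends_kernel_bound; lra. }
  assert (B3 : Rabs l3 <= eta * K).
  { replace (eta * K) with ((1 - (1 - eta)) * K) by ring.
    eapply is_RInt_le_const; [lra| |exact Hl3].
    intros; apply vanishing_ends_kernel_bound; lra. }
  assert (Hs : forall x, eta <= x <= 1 - eta -> eta <= sin (PI * x)).
  { intros x Hx; eapply Rle_trans; [|apply sin_PI_lower; lra].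
    apply Rmin_glb; lra. }
  (* On the middle piece the integrand is ph(x) sin(w x) with w = (2N+3) pi >= N + 1. Integration by
     parts, with boundary term [psi], gains 1/w; the price is the derivative [dph], which stays
     bounded because sin(pi x) >= eta there. *)
  set (ph := fun x => h x / sin (PI * x)).
  set (dph := fun x => h' x / sin (PI * x) - ph x * PI * cos (PI * x) / sin (PI * x)).
  set (psi := fun x => - (ph x * cos (w * x) / w)).
  assert (Dph : forall x, eta <= x <= 1 - eta -> is_derive ph x (dph x)).
  { intros x Hx; assert (S := Hs x Hx); unfold ph, dph, ph.
    destruct (Hh x) as [D _]; [lra|].
    auto_derive.
    - repeat split; [eexists; exact D|lra].
    - apply is_derive_unique in D; change (Derive (fun x : R => h x) x = h' x) in D.
      rewrite D; field; lra. }
  assert (Bph : forall x, eta <= x <= 1 - eta -> Rabs (ph x) <= K).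
  { intros; apply vanishing_ends_quotient_bound; lra. }
  assert (Bdph : forall x, eta <= x <= 1 - eta -> Rabs (dph x) <= K / eta + K * PI / eta).
  { intros x Hx; assert (S := Hs x Hx).
    assert (Q : forall y L, 0 <= L -> Rabs y <= L -> Rabs (y / sin (PI * x)) <= L / eta).
    { intros y L HL Hy; unfold Rdiv; rewrite Rabs_mult, Rabs_inv, (Rabs_pos_eq (sin _)) by lra.
      apply Rmult_le_compat; [apply Rabs_pos| |exact Hy|].
      - apply Rlt_le, Rinv_0_lt_compat; lra.
      - apply Rinv_le_contravar; lra. }
    unfold dph, Rminus; eapply Rle_trans; [apply Rabs_triang|]; rewrite Rabs_Ropp.
    apply Rplus_le_compat; apply Q.
    - exact K0.
    - apply HK; lra.
    - nra.
    - rewrite !Rabs_mult, (Rabs_pos_eq PI) by lra.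
      assert (C : Rabs (cos (PI * x)) <= 1) by apply Rabs_le, COS_bound.
      assert (B := Bph x Hx); assert (0 <= Rabs (ph x)) by apply Rabs_pos.
      assert (0 <= Rabs (cos (PI * x))) by apply Rabs_pos.
      rewrite <- (Rmult_1_r (K * PI)); apply Rmult_le_compat;
        [apply Rmult_le_pos; lra|lra|apply Rmult_le_compat_r; lra|lra]. }
  assert (Cph : forall x, eta <= x <= 1 - eta -> continuous ph x).
  { intros; apply (ex_derive_continuous (V := R_NormedModule)); eexists; apply Dph; assumption. }
  assert (Cdph : forall x, eta <= x <= 1 - eta -> continuous dph x).
  { intros x Hx; assert (S := Hs x Hx).
    assert (Ci : continuous (fun x => / sin (PI * x)) x)
      by (apply (ex_derive_continuous (V := R_NormedModule)); auto_derive; lra).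
    assert (Cc : continuous (fun x => cos (PI * x)) x)
      by (apply (ex_derive_continuous (V := R_NormedModule)); auto_derive; trivial).
    apply continuous_Rminus; apply continuous_Rmult; try exact Ci.
    - apply Hh; lra.
    - apply continuous_Rmult; [|exact Cc].
      apply continuous_Rmult; [apply Cph, Hx|apply continuous_const]. }
  assert (Csin : forall x, continuous (fun x => sin (w * x)) x).
  { intros; apply (ex_derive_continuous (V := R_NormedModule)); auto_derive; trivial. }
  assert (Ccos : forall x, continuous (fun x => cos (w * x) / w) x).
  { intros; apply (ex_derive_continuous (V := R_NormedModule)); auto_derive; lra. }
  assert (Dpsi : is_RInt (fun x => ph x * sin (w * x) - dph x * (cos (w * x) / w))
    eta (1 - eta) (psi (1 - eta) - psi eta)).
  { apply (is_RInt_derive (V := R_CompleteNormedModule) psi);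
      rewrite Rmin_left, Rmax_right by lra; intros x Hx.
    - assert (D := Dph x Hx); unfold psi.
      auto_derive; [repeat split; eexists; exact D|].
      apply is_derive_unique in D; change (Derive (fun x : R => ph x) x = dph x) in D.
      rewrite D; field; lra.
    - apply continuous_Rminus; apply continuous_Rmult;
        [apply Cph, Hx|apply Csin|apply Cdph, Hx|apply Ccos]. }
  assert (Drest : is_RInt (fun x => dph x * (cos (w * x) / w)) eta (1 - eta)
    (l2 - (psi (1 - eta) - psi eta))).
  { eapply is_RInt_ext; [|apply (is_RInt_minus (V := R_NormedModule)); [exact Hl2|exact Dpsi]].
    rewrite Rmin_left, Rmax_right by lra; intros x Hx.
    change (G x - (ph x * sin (w * x) - dph x * (cos (w * x) / w))
      = dph x * (cos (w * x) / w)).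
    assert (S := Hs x).
    replace (G x) with (ph x * sin (w * x)); [ring|].
    unfold G, ph, w; rewrite <- cosine_kernel_sin; field; lra. }
  set (T := K / eta + K * PI / eta) in *.
  assert (T0 : 0 <= T).
  { eapply Rle_trans; [apply Rabs_pos|apply (Bdph (1/2)); lra]. }
  assert (Bcos : forall x, Rabs (cos (w * x) / w) <= / INR (S N)).
  { intros x; unfold Rdiv; rewrite Rabs_mult, Rabs_inv, (Rabs_pos_eq w) by lra.
    rewrite <- (Rmult_1_l (/ INR (S N))); apply Rmult_le_compat.
    - apply Rabs_pos.
    - apply Rlt_le, Rinv_0_lt_compat; lra.
    - apply Rabs_le, COS_bound.
    - apply Rinv_le_contravar; lra. }
  assert (I0 : 0 < / INR (S N)) by (apply Rinv_0_lt_compat; exact HN).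
  assert (B2 : Rabs (l2 - (psi (1 - eta) - psi eta)) <= T * / INR (S N)).
  { apply Rle_trans with ((1 - eta - eta) * (T * / INR (S N))).
    - eapply is_RInt_le_const; [lra| |exact Drest].
      intros x Hx; cbv beta; rewrite Rabs_mult.
      apply Rmult_le_compat; try apply Rabs_pos; [apply Bdph, Hx|apply Bcos].
    - assert (0 <= T * / INR (S N)) by (apply Rmult_le_pos; lra); nra. }
  assert (Bpsi : forall x, eta <= x <= 1 - eta -> Rabs (psi x) <= K * / INR (S N)).
  { intros x Hx; unfold psi; rewrite Rabs_Ropp.
    replace (ph x * cos (w * x) / w) with (ph x * (cos (w * x) / w)) by (field; lra).
    rewrite Rabs_mult.
    apply Rmult_le_compat; try apply Rabs_pos; [apply Bph, Hx|apply Bcos]. }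
  assert (Bp1 := Bpsi eta); assert (Bp2 := Bpsi (1 - eta)).
  apply Rabs_le_between in B1; apply Rabs_le_between in B2; apply Rabs_le_between in B3.
  assert (X1 : Rabs (psi eta) <= K * / INR (S N)) by (apply Bp1; lra).
  assert (X2 : Rabs (psi (1 - eta)) <= K * / INR (S N)) by (apply Bp2; lra).
  apply Rabs_le_between in X1; apply Rabs_le_between in X2.
  unfold Rdiv; rewrite Rmult_plus_distr_r.
  rewrite E; apply Rabs_le; lra.
Qed.

End VanishingEnds.

(** Let h be [g] minus its linear interpolant. The integral of h * (1 + kernel) tends to 0 and the
    interpolant is orthogonal to the kernel, so the integral of g * kernel tends to minus the
    integral of h. The interpolant integrates to (g 0 + g 1) / 2, the trapezoidal value. *)
Lemma dirichlet_endpoints (g g' : R -> R) (K G : R) :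
  (forall x, 0 <= x <= 1 -> is_derive g x (g' x) /\ continuous g' x) ->
  (forall x, 0 <= x <= 1 -> Rabs (g' x) <= K) ->
  is_RInt g 0 1 G ->
  forall eps, 0 < eps -> exists N0 : nat, forall (N : nat) (l : R), (N0 <= N)%nat ->
    is_RInt (fun x => g x * cosine_kernel N x) 0 1 l ->
    Rabs (l - ((g 0 + g 1) / 2 - G)) <= eps.
Proof.
  intros Hg HK HG eps Heps; assert (P := two_PI_gt_2).
  set (A := g 0); set (B := g 1 - g 0).
  set (h := fun x => g x - (A + B * x)).
  assert (K0 : 0 <= K) by (eapply Rle_trans; [apply Rabs_pos|apply (HK 0); lra]).
  assert (HB : Rabs B <= K).
  { replace K with (K * (1 - 0)) by ring; apply (Rabs_mean_value g g'); [lra|].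
    intros x Hx; split; [apply Hg|apply HK]; assumption. }
  assert (Hh : forall x, 0 <= x <= 1 -> is_derive h x (g' x - B)
    /\ continuous (fun x => g' x - B) x).
  { intros x Hx; destruct (Hg x Hx) as [D C]; split.
    - unfold h; auto_derive; [repeat split; eexists; exact D|].
      apply is_derive_unique in D; change (Derive (fun x : R => g x) x = g' x) in D.
      rewrite D; ring.
    - apply continuous_Rminus; [exact C|apply continuous_const]. }
  (* The slope [B] is an increment of [g] over unit length, hence at most [K] itself. *)
  assert (HK' : forall x, 0 <= x <= 1 -> Rabs (g' x - B) <= 2 * K).
  { intros x Hx; unfold Rminus; eapply Rle_trans; [apply Rabs_triang|].
    rewrite Rabs_Ropp; assert (X := HK x Hx); lra. }
  assert (h0 : h 0 = 0) by (unfold h, A; ring).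
  assert (h1 : h 1 = 0) by (unfold h, A, B; ring).
  set (K2 := 2 * K) in *.
  (* Makes the end pieces 2 * eta * K2 at most eps/2; afterwards [N0] is chosen, depending on [eta],
     so that the middle piece is at most eps/2. *)
  set (eta := Rmin (1/4) (eps / (4 * (K2 + 1)))).
  assert (e0 : 0 < eta).
  { apply Rmin_pos; [lra|apply Rdiv_lt_0_compat; unfold K2; lra]. }
  assert (e1 : eta <= 1/4) by apply Rmin_l.
  assert (e2 : eta * (4 * (K2 + 1)) <= eps).
  { apply (Rmult_le_reg_r (/ (4 * (K2 + 1)))); [apply Rinv_0_lt_compat; unfold K2; lra|].
    rewrite Rmult_assoc, Rinv_r, Rmult_1_r by (unfold K2; lra); apply Rmin_r. }
  set (T := 2 * K2 + (K2 / eta + K2 * PI / eta)).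
  destruct (INR_unbounded (T / (eps / 2))) as [N0 HN0].
  exists N0; intros N l HN Hl.
  assert (HN1 : 0 < INR (S N)) by (apply lt_0_INR; lia).
  assert (HT : T / INR (S N) <= eps / 2).
  { apply (Rmult_le_reg_r (INR (S N))); [exact HN1|].
    unfold Rdiv at 1; rewrite Rmult_assoc, Rinv_l, Rmult_1_r by lra.
    assert (INR N0 <= INR (S N)) by (apply le_INR; lia).
    apply (Rmult_lt_compat_r (eps / 2)) in HN0; [|lra].
    unfold Rdiv at 1 in HN0; rewrite Rmult_assoc, Rinv_l, Rmult_1_r in HN0 by lra.
    nra. }
  assert (Hlin : is_RInt (fun x => A + B * x) 0 1 ((g 0 + g 1) / 2)).
  { replace ((g 0 + g 1) / 2) with ((A * 1 + B * (1 * 1 / 2)) - (A * 0 + B * (0 * 0 / 2)))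
      by (unfold A, B; field).
    apply (is_RInt_derive (V := R_CompleteNormedModule) (fun x => A * x + B * (x * x / 2))).
    - intros; auto_derive; [trivial|field].
    - intros; apply (ex_derive_continuous (V := R_NormedModule)); auto_derive; trivial. }
  assert (X : Rabs (l - 0 + (G - (g 0 + g 1) / 2)) <= 2 * eta * K2 + T / INR (S N)).
  { apply (vanishing_ends_kernel_integral h (fun x => g' x - B) K2 Hh HK' h0 h1); [lra|].
    eapply is_RInt_ext; [|apply (is_RInt_plus (V := R_NormedModule));
      [apply (is_RInt_minus (V := R_NormedModule)); [exact Hl|apply (linear_kernel_integral A B N)]
      |apply (is_RInt_minus (V := R_NormedModule)); [exact HG|exact Hlin]]].
    intros x _; unfold h.
    change (g x * cosine_kernel N x - (A + B * x) * cosine_kernel N x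
      + (g x - (A + B * x)) = (g x - (A + B * x)) * (1 + cosine_kernel N x)).
    ring. }
  replace (l - ((A + g 1) / 2 - G)) with (l - 0 + (G - (g 0 + g 1) / 2))
    by (unfold A; ring).
  assert (2 * eta * K2 <= eps / 2) by (unfold K2 in *; nra).
  eapply Rle_trans; [exact X|]; lra.
Qed.

End DirichletKernel.

(** * Hermite's formula *)

(** [fourier_mode_cos] summed over j <= N, with the geometric sum of u (1-u)^j in closed form. *)
Lemma kernel_identity (f f' : C -> C) (a : C) (M : R) (N : nat) :
  is_rhp_derive f f' -> rhp_continuous f -> rhp_continuous f' -> (0 < Re a)%R ->
  (forall z, (Re a <= Re z)%R -> (Cmod (f z) <= M)%R) ->
  exists c : C,
  is_CInt (fun x => f (a + RtoC x) * RtoC (cosine_kernel N x)) 0 1 c /\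
  is_CInt (fun u => (hermite_integrand f a u - hermite_integrand f (a + RtoC 1) u)
                    * RtoC (1 - (1 - u) ^ S N)) 0 1 (RtoC (2 * PI) * Ci * c).
Proof.
  intros Hf Cf Cf' Ha HM; induction N as [|N (c & H1 & H2)].
  - destruct (fourier_mode_cos f f' a M 0 Hf Cf Cf' Ha HM) as (J & H1 & H2).
    exists J; split.
    + eapply is_CInt_ext; [|exact H1]; intros x _; cbv beta.
      unfold cosine_kernel; rewrite sum_O; reflexivity.
    + eapply is_CInt_ext; [|exact H2]; intros u _; cbv beta.
      do 2 f_equal; simpl; ring.
  - destruct (fourier_mode_cos f f' a M (S N) Hf Cf Cf' Ha HM) as (J & H3 & H4).
    exists (c + J); split.
    + eapply is_CInt_ext; [|apply is_CInt_plus; [exact H1|exact H3]].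
      intros x _; cbv beta; rewrite <- Cmult_plus_distr_l, <- RtoC_plus.
      unfold cosine_kernel; rewrite sum_Sn; reflexivity.
    + rewrite Cmult_plus_distr_l.
      eapply is_CInt_ext; [|apply is_CInt_plus; [exact H2|exact H4]].
      intros u _; cbv beta; rewrite <- Cmult_plus_distr_l, <- RtoC_plus.
      do 2 f_equal; simpl; ring.
Qed.

Lemma Cmod_small_eq_0 (z : C) : (forall eps, (0 < eps)%R -> (Cmod z <= eps)%R) -> z = 0.
Proof.
  intros H; apply Cmod_eq_0, Rle_antisym; [|apply Cmod_ge_0].
  apply Rnot_lt_le; intros Hp; assert (X := H (Cmod z / 2)%R ltac:(lra)); lra.
Qed.

(** The limit of [kernel_identity] as N grows: Dirichlet's theorem on the side of [cN], and on the
    other side the vanishing of the integral against (1-u)^(N+1). *)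
Lemma trapezoid_correction (f f' : C -> C) (a : C) (M : R) (Ja Jb I : C) :
  is_rhp_derive f f' -> rhp_continuous f -> rhp_continuous f' -> (0 < Re a)%R ->
  (forall z, (Re a <= Re z)%R -> (Cmod (f z) <= M)%R /\ (Cmod (f' z) <= M)%R) ->
  is_CInt (hermite_integrand f a) 0 1 Ja ->
  is_CInt (hermite_integrand f (a + RtoC 1)) 0 1 Jb ->
  is_CInt (fun x => f (a + RtoC x)) 0 1 I ->
  Ja - Jb = RtoC (2 * PI) * Ci * ((f a + f (a + RtoC 1)) / RtoC 2 - I).
Proof.
  intros Hf Cf Cf' Ha HM HJa HJb HI; assert (P := two_PI_gt_2).
  assert (M0 : (0 <= M)%R).
  { eapply Rle_trans; [apply Cmod_ge_0|apply (HM a); lra]. }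
  set (c := (f a + f (a + RtoC 1)) / RtoC 2 - I).
  assert (Hpath : forall x, (0 <= x <= 1)%R ->
    is_Cderive (fun x => f (a + RtoC x)) x (f' (a + RtoC x))
    /\ Ccontinuous (fun x => f' (a + RtoC x)) x
    /\ (Re a <= Re (a + RtoC x))%R).
  { intros x Hx.
    assert (Hr : (Re a <= Re (a + RtoC x))%R) by (simpl; unfold Re; lra).
    split; [|split; [|exact Hr]].
    - eapply is_Cderive_eq; [apply Hf; [lra|]|].
      + apply is_Cderive_plus; [apply is_Cderive_const|].
        apply is_Cderive_RtoC, is_derive_id.
      + change (@one R_AbsRing) with 1%R; cbv beta; ring.
    - apply Cf'; [lra|].
      apply Ccontinuous_plus; [apply Ccontinuous_const|].
      apply Ccontinuous_RtoC, continuous_id. }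
  assert (E0 : a + RtoC 0 = a) by ring.
  apply is_CInt_iff in HI; destruct HI as [HI1 HI2].
  assert (D1 := dirichlet_endpoints (fun x => Re (f (a + RtoC x)))
    (fun x => Re (f' (a + RtoC x))) M (Re I)
    ltac:(intros x Hx; destruct (Hpath x Hx) as ([? _] & [? _] & _); split; assumption)
    ltac:(intros x Hx; eapply Rle_trans; [apply re_le_Cmod|apply HM, Hpath, Hx]) HI1).
  assert (D2 := dirichlet_endpoints (fun x => Im (f (a + RtoC x)))
    (fun x => Im (f' (a + RtoC x))) M (Im I)
    ltac:(intros x Hx; destruct (Hpath x Hx) as ([_ ?] & [_ ?] & _); split; assumption)
    ltac:(intros x Hx; eapply Rle_trans; [apply im_le_Cmod|apply HM, Hpath, Hx]) HI2).
  cbv beta in D1, D2; rewrite E0 in D1, D2.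
  assert (Hc : forall eps, (0 < eps)%R -> (Cmod (Ja - Jb - RtoC (2 * PI) * Ci * c) <= eps)%R).
  { intros eps He.
    (* An error [e] in each component gives |cN - c| <= 2 * e, and 2 pi * 2 * e = eps/2. *)
    set (e := (eps / (8 * PI))%R).
    assert (e0 : (0 < e)%R) by (apply Rdiv_lt_0_compat; lra).
    destruct (D1 e e0) as [N1 HN1]; destruct (D2 e e0) as [N2 HN2].
    destruct (INR_unbounded (8 * M / (eps / 2))) as [N3 HN3].
    set (N := (N1 + N2 + N3)%nat).
    destruct (kernel_identity f f' a M N Hf Cf Cf' Ha) as (cN & K1 & K2).
    { intros z Hz; apply HM, Hz. }
    assert (B1 : (Cmod (cN - c) <= 2 * e)%R).
    { apply is_CInt_iff in K1; destruct K1 as [K1 K1'].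
      apply Cmod_le_Re_Im.
      - replace (Re (cN - c))
          with (Re cN - ((Re (f a) + Re (f (a + RtoC 1)%C)) / 2 - Re I))%R.
        + apply (HN1 N); [unfold N; lia|].
          eapply is_RInt_ext; [|exact K1]; intros x _; cbv beta.
          rewrite Re_mult; simpl; unfold Re, Im; simpl; ring.
        + unfold c; simpl; unfold Re; simpl; field.
      - replace (Im (cN - c))
          with (Im cN - ((Im (f a) + Im (f (a + RtoC 1)%C)) / 2 - Im I))%R.
        + apply (HN2 N); [unfold N; lia|].
          eapply is_RInt_ext; [|exact K1']; intros x _; cbv beta.
          rewrite Im_mult; simpl; unfold Re, Im; simpl; ring.
        + unfold c; simpl; unfold Im; simpl; field. }
    (* The remaining integrand carries (1-u)^(N+1), and each of the two Hermite integrands is at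
       most 4 * M; the majorant integrates to 8 * M / (N + 2). *)
    assert (B2 : (Cmod (Ja - Jb - RtoC (2 * PI) * Ci * cN) <= 8 * M / INR (N + 2))%R).
    { apply (is_CInt_bound_fun (fun u =>
        (hermite_integrand f a u - hermite_integrand f (a + RtoC 1) u)
        * RtoC ((1 - u) ^ S N)) (fun u => 8 * M * (1 - u) ^ S N)%R 0 1).
      - lra.
      - intros u Hu.
        rewrite Cmod_mult, Cmod_R, Rabs_pos_eq by (apply pow_le; lra).
        apply Rmult_le_compat_r; [apply pow_le; lra|].
        unfold Cminus; eapply Rle_trans; [apply Cmod_triangle|]; rewrite Cmod_opp.
        assert (X1 := hermite_integrand_bound f f' a M u Hf Ha
          ltac:(intros z Hz; apply HM; lra) Hu).
        assert (X2 := hermite_integrand_bound f f' (a + RtoC 1) M u Hf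
          ltac:(simpl; unfold Re in *; lra)
          ltac:(intros z Hz; apply HM; simpl in Hz; unfold Re in *; lra) Hu).
        lra.
      - eapply is_CInt_ext;
          [|apply is_CInt_minus; [apply is_CInt_minus; [exact HJa|exact HJb]|exact K2]].
        intros u _; cbv beta; rewrite RtoC_minus; ring.
      - assert (HN : (0 < INR (N + 2))%R) by (apply lt_0_INR; lia).
        set (F := fun u => (- (8 * M) * (1 - u) ^ (N + 2) / INR (N + 2))%R).
        replace (8 * M / INR (N + 2))%R with (F 1 - F 0)%R.
        + apply (is_RInt_derive (V := R_CompleteNormedModule) F).
          * intros u _; unfold F; auto_derive; [trivial|].
            replace (Init.Nat.pred (N + 2)) with (S N) by lia; fold (1 - u)%R; field; lra.
          * intros u _; apply (ex_derive_continuous (V := R_NormedModule));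
              auto_derive; trivial.
        + unfold F; rewrite Rminus_diag, pow_i, Rminus_0_r, pow1 by lia; field; lra. }
    assert (B3 : (8 * M / INR (N + 2) <= eps / 2)%R).
    { assert (HN : (INR N3 <= INR (N + 2))%R) by (apply le_INR; unfold N; lia).
      assert (HNp : (0 < INR (N + 2))%R) by (apply lt_0_INR; lia).
      apply (Rmult_le_reg_r (INR (N + 2))); [exact HNp|].
      unfold Rdiv at 1; rewrite Rmult_assoc, Rinv_l, Rmult_1_r by lra.
      apply (Rmult_lt_compat_r (eps / 2)) in HN3; [|lra].
      unfold Rdiv at 1 in HN3; rewrite Rmult_assoc, Rinv_l, Rmult_1_r in HN3 by lra.
      nra. }
    replace (Ja - Jb - RtoC (2 * PI) * Ci * c)
      with ((Ja - Jb - RtoC (2 * PI) * Ci * cN) + RtoC (2 * PI) * Ci * (cN - c)) by ring.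
    eapply Rle_trans; [apply Cmod_triangle|].
    rewrite 2!Cmod_mult, Cmod_Ci, Cmod_R, Rabs_pos_eq by lra.
    assert (2 * PI * 1 * Cmod (cN - c) <= 2 * PI * 1 * (2 * e))%R
      by (apply Rmult_le_compat_l; lra).
    assert (2 * PI * 1 * (2 * e) = eps / 2)%R by (unfold e; field; lra).
    lra. }
  apply Cmod_small_eq_0 in Hc.
  replace (Ja - Jb) with ((Ja - Jb - RtoC (2 * PI) * Ci * c) + RtoC (2 * PI) * Ci * c) by ring.
  rewrite Hc; ring.
Qed.

(** * The powers z^(-t) and z^(-1-t) *)

Lemma exp_le_compat (x y : R) : (x <= y)%R -> (exp x <= exp y)%R.
Proof.
  intros [H| ->]; [apply Rlt_le, exp_increasing, H|apply Rle_refl].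
Qed.

Lemma rhp_derive_Cln : is_rhp_derive Cln (fun z => / z).
Proof. intros p t l Hp Hl; apply is_Cderive_Cln; assumption. Qed.

Lemma rhp_derive_inv : is_rhp_derive (fun z => / z) (fun z => - (/ (z * z))).
Proof.
  intros p t l Hp Hl; eapply is_Cderive_eq.
  - apply is_Cderive_inv; [apply Re_pos_neq_0, Hp|exact Hl].
  - unfold Cdiv; ring.
Qed.

Lemma rhp_continuous_inv : rhp_continuous (fun z => / z).
Proof.
  intros U p x Hp Hx; apply Ccontinuous_inv; [apply Re_pos_neq_0, Hp|exact Hx].
Qed.

(** The power z^(-t). Divided by -t it is a primitive of [shifted_power t], and as a^(1-s) it is
    also the numerator of the second term of Hermite's formula. *)
Definition Cln_exp (t : R) (z : C) : C := Cexp (- RtoC t * Cln z).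

(* z ^ (-1 - t) *)
Definition shifted_power (t : R) (z : C) : C := Cln_exp t z / z.

Lemma rhp_derive_Cln_exp (t : R) :
  is_rhp_derive (Cln_exp t) (fun z => - RtoC t * shifted_power t z).
Proof.
  intros p x l Hp Hl; eapply is_Cderive_eq.
  - apply is_Cderive_Cexp, is_Cderive_scal, rhp_derive_Cln; eassumption.
  - unfold shifted_power, Cdiv; fold (Cln_exp t (p x)); ring.
Qed.

Lemma rhp_continuous_Cln_exp (t : R) : rhp_continuous (Cln_exp t).
Proof.
  intros U p x Hp Hx; apply Ccontinuous_Cexp, Ccontinuous_mult;
    [apply Ccontinuous_const|apply Ccontinuous_Cln; assumption].
Qed.

Lemma rhp_derive_shifted_power (t : R) :
  is_rhp_derive (shifted_power t) (fun z => - RtoC (1 + t) * (shifted_power t z / z)).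
Proof.
  intros p x l Hp Hl; eapply is_Cderive_eq.
  - apply is_Cderive_mult; [apply rhp_derive_Cln_exp|apply rhp_derive_inv]; eassumption.
  - cbv beta; unfold shifted_power, Cdiv; rewrite RtoC_plus.
    field; apply Re_pos_neq_0, Hp.
Qed.

Lemma rhp_continuous_shifted_power (t : R) : rhp_continuous (shifted_power t).
Proof.
  intros U p x Hp Hx; apply Ccontinuous_mult;
    [apply rhp_continuous_Cln_exp|apply rhp_continuous_inv]; assumption.
Qed.

Lemma Cmod_Cln_exp (t : R) (z : C) : Cmod (Cln_exp t z) = exp (- t * ln (Cmod z)).
Proof.
  unfold Cln_exp; rewrite Cmod_Cexp; f_equal.
  simpl; ring.
Qed.

Lemma Re_le_Cmod (z : C) : (Re z <= Cmod z)%R.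
Proof. eapply Rle_trans; [apply Rle_abs|apply re_le_Cmod]. Qed.

Lemma Cmod_Cln_exp_le (t : R) (z : C) (b : R) :
  (0 < t)%R -> (0 < b <= Re z)%R -> (Cmod (Cln_exp t z) <= exp (- t * ln b))%R.
Proof.
  intros Ht Hb; rewrite Cmod_Cln_exp; apply exp_le_compat.
  assert (H := Re_le_Cmod z).
  assert (ln b <= ln (Cmod z))%R by (apply ln_le; lra).
  nra.
Qed.

(** A single bound for the function and its derivative, since the estimates for [hermite_integrand]
    take one constant. The factor b^(-t) makes it tend to 0 as b grows, however small t > 0 is. *)
Lemma shifted_power_bound (t : R) (z : C) (b : R) :
  (0 < t)%R -> (0 < b <= Re z)%R ->
  (Cmod (shifted_power t z) <= (1 + t) * (/ b + / (b * b)) * exp (- t * ln b))%R /\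
  (Cmod (- RtoC (1 + t) * (shifted_power t z / z))
     <= (1 + t) * (/ b + / (b * b)) * exp (- t * ln b))%R.
Proof.
  intros Ht Hb; assert (H := Cmod_Cln_exp_le t z b Ht Hb).
  assert (Hz : z <> 0) by (apply Re_pos_neq_0; lra).
  assert (Hm := Re_le_Cmod z).
  set (E := exp (- t * ln b)) in *.
  assert (E0 : (0 < E)%R) by apply exp_pos.
  assert (I : (0 < / Cmod z <= / b)%R).
  { split; [apply Rinv_0_lt_compat; lra|apply Rinv_le_contravar; lra]. }
  assert (B1 : (Cmod (shifted_power t z) <= / b * E)%R).
  { unfold shifted_power; rewrite Cmod_div by exact Hz; unfold Rdiv.
    rewrite Rmult_comm; apply Rmult_le_compat; try lra; apply Cmod_ge_0. }
  assert (B2 : (Cmod (shifted_power t z / z) <= / (b * b) * E)%R).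
  { rewrite Cmod_div by exact Hz; unfold Rdiv; rewrite Rmult_comm.
    replace (/ (b * b) * E)%R with (/ b * (/ b * E))%R by (field; lra).
    apply Rmult_le_compat; try lra; apply Cmod_ge_0. }
  assert (Ib2 : (0 < / (b * b))%R) by (apply Rinv_0_lt_compat; nra).
  assert (X1 : (0 <= / b * E)%R) by nra.
  assert (X2 : (0 <= / (b * b) * E)%R) by nra.
  split.
  - nra.
  - rewrite Cmod_mult, Cmod_opp, Cmod_R, Rabs_pos_eq by lra. nra.
Qed.

Definition hermite_value (t : R) (a J : C) : C :=
  shifted_power t a / RtoC 2 + Cln_exp t a / RtoC t + J / (RtoC (2 * PI) * Ci).

(** [trapezoid_correction] with the integral over [a, a+1] equal to (a^(-t) - (a+1)^(-t)) / t, which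
    cancels the middle terms of the two Hermite values; half the sum plus half the difference of the
    end values is f(a). *)
Lemma hermite_value_step (t : R) (a Ja Jb : C) :
  (0 < t)%R -> (0 < Re a)%R ->
  is_CInt (hermite_integrand (shifted_power t) a) 0 1 Ja ->
  is_CInt (hermite_integrand (shifted_power t) (a + RtoC 1)) 0 1 Jb ->
  shifted_power t a = hermite_value t a Ja - hermite_value t (a + RtoC 1) Jb.
Proof.
  intros Ht Ha HJa HJb; assert (P := two_PI_gt_2).
  assert (HI : is_CInt (fun x => shifted_power t (a + RtoC x)) 0 1
    (- / RtoC t * (Cln_exp t (a + RtoC 1) - Cln_exp t a))).
  { apply (is_CInt_ext (fun x => - / RtoC t * (- RtoC t * shifted_power t (a + RtoC x)))).
    { intros; field; apply RtoC_neq_0; lra. }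
    apply is_CInt_scal.
    replace (Cln_exp t a) with (Cln_exp t (a + RtoC 0)) by (f_equal; ring).
    apply (is_CInt_derive (fun x => Cln_exp t (a + RtoC x))); [lra|].
    intros x Hx.
    assert (Hr : (0 < Re (a + RtoC x))%R) by (simpl; unfold Re in *; lra).
    split.
    - eapply is_Cderive_eq; [apply rhp_derive_Cln_exp; [exact Hr|]|].
      + apply is_Cderive_plus; [apply is_Cderive_const|].
        apply is_Cderive_RtoC, is_derive_id.
      + change (@one R_AbsRing) with 1%R; cbv beta; ring.
    - apply Ccontinuous_mult; [apply Ccontinuous_const|].
      apply rhp_continuous_shifted_power; [exact Hr|].
      apply Ccontinuous_plus; [apply Ccontinuous_const|].
      apply Ccontinuous_RtoC, continuous_id. }
  assert (T := trapezoid_correction (shifted_power t) _ a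
    ((1 + t) * (/ Re a + / (Re a * Re a)) * exp (- t * ln (Re a)))%R Ja Jb
    (- / RtoC t * (Cln_exp t (a + RtoC 1) - Cln_exp t a))
    (rhp_derive_shifted_power t) (rhp_continuous_shifted_power t)).
  assert (E : Ja - Jb = RtoC (2 * PI) * Ci
    * ((shifted_power t a + shifted_power t (a + RtoC 1)) / RtoC 2
       - - / RtoC t * (Cln_exp t (a + RtoC 1) - Cln_exp t a))).
  { apply T; try assumption.
    - intros U p x Hp Hx; apply Ccontinuous_mult; [apply Ccontinuous_const|].
      apply Ccontinuous_div; [apply Re_pos_neq_0, Hp| |exact Hx].
      apply rhp_continuous_shifted_power; assumption.
    - intros z Hz; apply shifted_power_bound; lra. }
  unfold hermite_value.
  assert (H2 : RtoC 2 <> 0) by (apply RtoC_neq_0; lra).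
  assert (Ht0 : RtoC t <> 0) by (apply RtoC_neq_0; lra).
  assert (HP : RtoC (2 * PI) <> 0) by (apply RtoC_neq_0; lra).
  assert (Hi := Ci_neq_0).
  replace Ja with (Jb + (Ja - Jb)) by ring; rewrite E.
  set (c := RtoC (2 * PI)) in *; set (w := RtoC 2) in *.
  (* After the [set], [w] is an atom for [field_simplify_eq]; its relation to 1 has to be supplied
     before [ring]. *)
  assert (W : w = RtoC 1 + RtoC 1) by (unfold w; rewrite <- RtoC_plus; f_equal; ring).
  field_simplify_eq; [rewrite W; ring|repeat split; assumption].
Qed.

Lemma series_terms (t : R) (z : C) :
  (0 < Re z)%R -> Cpower z (- RtoC (1 + t)) = shifted_power t z.
Proof.
  intros Hz; unfold Cpower, shifted_power, Cln_exp.
  assert (Hz0 := Re_pos_neq_0 z Hz).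
  replace (- RtoC (1 + t) * Cln z) with (- RtoC t * Cln z + - Cln z)
    by (rewrite RtoC_plus; ring).
  rewrite Cexp_plus; unfold Cdiv; f_equal.
  transitivity (Cexp (- Cln z) * Cexp (Cln z) / z).
  - rewrite Cexp_Cln by exact Hz; field; exact Hz0.
  - rewrite <- Cexp_plus; replace (- Cln z + Cln z) with (RtoC 0) by ring.
    rewrite Cexp_0; field; exact Hz0.
Qed.

Lemma is_series_Cmod (u : nat -> C) (l : C) :
  is_series (K := C_AbsRing) (V := C_NormedModule) u l ->
  forall eps, (0 < eps)%R -> exists N0 : nat, forall N, (N0 <= N)%nat ->
    (Cmod (sum_n u N - l) <= eps)%R.
Proof.
  intros H eps He.
  assert (H' := proj1 (filterlim_locally_ball_norm (K := C_AbsRing) (U := C_NormedModule)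
    _ _) H (mkposreal _ He)).
  destruct H' as [N0 HN0]; exists N0; intros N HN; apply Rlt_le, (HN0 N HN).
Qed.

Lemma exp_ln_decay (t eps : R) :
  (0 < t)%R -> (0 < eps)%R ->
  exists N0 : nat, forall b, (INR N0 <= b)%R -> (0 < b)%R -> (exp (- t * ln b) <= eps)%R.
Proof.
  intros Ht He; destruct (INR_unbounded (exp (- ln eps / t))) as [N0 HN0].
  exists N0; intros b Hb Hb0.
  rewrite <- (exp_ln eps) at 1 by exact He; apply exp_le_compat.
  assert (H : (- ln eps / t <= ln b)%R).
  { rewrite <- (ln_exp (- ln eps / t)); apply ln_le; [apply exp_pos|lra]. }
  apply (Rmult_le_compat_l t) in H; [|lra].
  replace (t * (- ln eps / t))%R with (- ln eps)%R in H by (field; lra).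
  lra.
Qed.

(** By [hermite_value_step] the partial sums telescope to H(0) - H(N+1), and all three terms of H(n)
    tend to 0. *)
Lemma hermite_formula (t : R) (a z J : C) :
  (0 < t)%R -> (0 < Re a)%R ->
  is_series (K := C_AbsRing) (V := C_NormedModule)
    (fun n : nat => Cpower (RtoC (INR n) + a) (- RtoC (1 + t))) z ->
  is_CInt (hermite_integrand (shifted_power t) a) 0 1 J ->
  z = hermite_value t a J.
Proof.
  intros Ht Ha Hz HJ; assert (P := two_PI_gt_2).
  set (s := fun n : nat => a + RtoC (INR n)).
  assert (Hs : forall n, Re (s n) = (Re a + INR n)%R) by (intros; reflexivity).
  assert (Hp : forall n, (0 < Re (s n))%R)
    by (intros n; rewrite Hs; generalize (pos_INR n); lra).
  set (Bd := fun b => ((1 + t) * (/ b + / (b * b)) * exp (- t * ln b))%R).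
  assert (HB : forall n w, Re w = Re (s n) -> (Cmod (shifted_power t w) <= Bd (Re (s n)))%R
    /\ (Cmod (- RtoC (1 + t) * (shifted_power t w / w))%C <= Bd (Re (s n)))%R).
  { intros n w Hw; apply shifted_power_bound; [exact Ht|].
    rewrite Hw; split; [apply Hp|lra]. }
  set (I := fun n => RInt (V := C_R_CompleteNormedModule)
    (hermite_integrand (shifted_power t) (s n)) 0 1).
  assert (HI : forall n, is_CInt (hermite_integrand (shifted_power t) (s n)) 0 1 (I n)).
  { intros n; destruct (hermite_integral_exists (shifted_power t) _ (s n) _
      (rhp_derive_shifted_power t) (Hp n) (HB n)) as [l Hl].
    apply (RInt_correct (V := C_R_CompleteNormedModule)); exists l; exact Hl. }
  assert (Es : forall n, s (S n) = s n + RtoC 1).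
  { intros n; unfold s; rewrite S_INR, RtoC_plus; ring. }
  assert (E0 : s 0%nat = a) by (unfold s; simpl; ring).
  assert (EJ : J = I 0%nat).
  { apply (is_CInt_unique _ _ _ _ _ HJ); rewrite <- E0; apply HI. }
  set (H := fun n => hermite_value t (s n) (I n)).
  assert (Hsum : forall N, sum_n (fun n : nat => Cpower (RtoC (INR n) + a) (- RtoC (1 + t))) N
    = H 0%nat - H (S N)).
  { assert (Hterm : forall n, Cpower (RtoC (INR n) + a) (- RtoC (1 + t)) = H n - H (S n)).
    { intros n; rewrite Cplus_comm; fold (s n); rewrite series_terms by apply Hp.
      unfold H; rewrite Es; apply hermite_value_step; try assumption.
      - apply Hp.
      - apply HI.
      - rewrite <- Es; apply HI. }
    induction N as [|N IH].
    - rewrite sum_O; apply Hterm.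
    - rewrite sum_Sn, IH, Hterm; change (H 0%nat - H (S N) + (H (S N) - H (S (S N)))
        = H 0%nat - H (S (S N))); ring. }
  (* From n = 1 on the real part b is at least 1, so 1/b and 1/b^2 are at most 1 and b^(-t) alone
     carries the decay. The constant is generous. *)
  assert (Hdecay : forall n, (1 <= n)%nat ->
    (Cmod (H n) <= (1 + 5 * (1 + t) + / t) * (2 * exp (- t * ln (Re (s n)))))%R).
  { intros n Hn.
    assert (H1 : (1 <= Re (s n))%R).
    { rewrite Hs; apply le_INR in Hn; simpl in Hn; lra. }
    set (b := Re (s n)) in *; set (E := exp (- t * ln b)).
    assert (HE : (0 < E)%R) by apply exp_pos.
    assert (Hb : (0 < / b <= 1)%R).
    { split; [apply Rinv_0_lt_compat; lra|].
      rewrite <- Rinv_1; apply Rinv_le_contravar; lra. }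
    assert (Hb2 : (0 < / (b * b) <= 1)%R).
    { split; [apply Rinv_0_lt_compat; nra|].
      rewrite <- Rinv_1; apply Rinv_le_contravar; nra. }
    assert (HBd : (Bd b <= (1 + t) * (2 * E))%R).
    { unfold Bd; fold E; rewrite Rmult_assoc; apply Rmult_le_compat_l; [lra|]; nra. }
    assert (X1 : (Cmod (shifted_power t (s n)) <= (1 + t) * (2 * E))%R).
    { eapply Rle_trans; [apply (HB n (s n) eq_refl)|exact HBd]. }
    assert (X2 : (Cmod (Cln_exp t (s n)) <= E)%R).
    { apply Cmod_Cln_exp_le; fold b; lra. }
    assert (X3 : (Cmod (I n) <= 4 * ((1 + t) * (2 * E)))%R).
    { eapply Rle_trans; [eapply (hermite_integral_bound (shifted_power t) _ (s n));
        [apply rhp_derive_shifted_power|apply Hp|apply HB|apply HI]|fold b; lra]. }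
    unfold H, hermite_value.
    eapply Rle_trans; [apply Cmod_triangle|].
    eapply Rle_trans; [apply Rplus_le_compat_r, Cmod_triangle|].
    assert (HP : RtoC (2 * PI) * Ci <> 0).
    { apply Cmult_neq_0; [apply RtoC_neq_0; lra|apply Ci_neq_0]. }
    rewrite !Cmod_div by (try exact HP; apply RtoC_neq_0; lra).
    rewrite Cmod_mult, Cmod_Ci, !Cmod_R, !Rabs_pos_eq by lra.
    assert (It : (0 < / t)%R) by (apply Rinv_0_lt_compat; exact Ht).
    assert (Ip : (0 < / (2 * PI * 1) <= 1)%R).
    { split; [apply Rinv_0_lt_compat; lra|].
      rewrite <- Rinv_1; apply Rinv_le_contravar; lra. }
    unfold Rdiv.
    assert (Y2 : (Cmod (Cln_exp t (s n)) * / t <= E * / t)%R)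
      by (apply Rmult_le_compat_r; lra).
    assert (Y3 : (Cmod (I n) * / (2 * PI * 1) <= 4 * ((1 + t) * (2 * E)) * 1)%R).
    { apply Rmult_le_compat; try lra; apply Cmod_ge_0. }
    assert (0 <= E * / t)%R by nra.
    assert (0 <= t * E)%R by nra.
    assert (X0 := Cmod_ge_0 (shifted_power t (s n))).
    nra. }
  assert (Hlim : z - H 0%nat = 0).
  { apply Cmod_small_eq_0; intros eps He.
    destruct (is_series_Cmod _ _ Hz (eps / 2) ltac:(lra)) as [N1 HN1].
    set (K := (1 + 5 * (1 + t) + / t)%R) in *.
    assert (It : (0 < / t)%R) by (apply Rinv_0_lt_compat; exact Ht).
    assert (K0 : (0 < K)%R) by (unfold K; lra).
    destruct (exp_ln_decay t (eps / (4 * K)) Ht) as [N2 HN2].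
    { apply Rdiv_lt_0_compat; lra. }
    assert (A1 := HN1 (N1 + N2)%nat ltac:(lia)).
    rewrite Hsum in A1.
    assert (A2 := Hdecay (S (N1 + N2)) ltac:(lia)).
    assert (A3 : (exp (- t * ln (Re (s (S (N1 + N2))))) <= eps / (4 * K))%R).
    { apply HN2; [|apply Hp]; rewrite Hs.
      assert (INR N2 <= INR (S (N1 + N2)))%R by (apply le_INR; lia); lra. }
    assert (A4 : (K * (2 * (eps / (4 * K))) = eps / 2)%R) by (field; lra).
    assert (A5 : (K * (2 * exp (- t * ln (Re (s (S (N1 + N2)))))) <= eps / 2)%R).
    { rewrite <- A4; apply Rmult_le_compat_l; lra. }
    replace (z - H 0%nat)
      with (- ((H 0%nat - H (S (N1 + N2)) - z) + H (S (N1 + N2)))) by ring.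
    rewrite Cmod_opp; eapply Rle_trans; [apply Cmod_triangle|]; lra. }
  replace z with (z - H 0%nat + H 0%nat) by ring.
  rewrite Hlim; unfold H; rewrite <- EJ, E0; ring.
Qed.

(** * Expansion in powers of s - 1 *)

Lemma is_Cderive_pow (f : R -> C) (t : R) (l : C) (n : nat) :
  is_Cderive f t l ->
  is_Cderive (fun x => f x ^ n) t (l * (RtoC (INR n) * f t ^ Nat.pred n)).
Proof.
  intros H; induction n as [|n IH].
  - eapply is_Cderive_eq; [apply (is_Cderive_const (RtoC 1))|simpl; ring].
  - eapply is_Cderive_eq; [apply (is_Cderive_mult f (fun x => f x ^ n)); [exact H|exact IH]|].
    cbv beta; rewrite S_INR, RtoC_plus; destruct n as [|n]; simpl; ring.
Qed.

(** The remainder exp(w) - sum_{k<n} w^k / k!. *)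
Fixpoint exp_tail (n : nat) (w : C) : C :=
  match n with
  | O => Cexp w
  | S n => exp_tail n w - w ^ n / RtoC (INR (fact n))
  end.

Lemma INR_fact_C_neq_0 (n : nat) : RtoC (INR (fact n)) <> 0.
Proof. apply RtoC_neq_0, INR_fact_neq_0. Qed.

(** Differentiation lowers the order by one; the convention [Nat.pred 0 = 0] is right here because
    exp is its own derivative. *)
Lemma is_Cderive_exp_tail (n : nat) (f : R -> C) (t : R) (l : C) :
  is_Cderive f t l ->
  is_Cderive (fun x => exp_tail n (f x)) t (l * exp_tail (Nat.pred n) (f t)).
Proof.
  intros H; induction n as [|n IH]; [apply is_Cderive_Cexp, H|].
  simpl exp_tail; eapply is_Cderive_eq.
  - apply is_Cderive_minus; [exact IH|].
    apply is_Cderive_mult; [apply is_Cderive_pow, H|apply is_Cderive_const].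
  - destruct n as [|n]; [simpl; ring|].
    assert (F1 := INR_fact_C_neq_0 n).
    assert (F2 : RtoC (INR (S n)) <> 0) by (apply RtoC_neq_0, not_0_INR; lia).
    simpl exp_tail; simpl Nat.pred; cbv beta.
    replace (INR (fact (S n))) with (INR (S n) * INR (fact n))%R
      by (rewrite <- mult_INR; reflexivity).
    rewrite RtoC_mult; field; split; assumption.
Qed.

Lemma exp_tail_0 (n : nat) : exp_tail (S n) 0 = 0.
Proof.
  induction n as [|n IH].
  - simpl; rewrite Cexp_0; field.
  - change (exp_tail (S n) 0 - 0 ^ S n / RtoC (INR (fact (S n))) = 0).
    rewrite IH; simpl Cpow; unfold Cdiv; ring.
Qed.

(** Mean value inequality on the segment from 0 to [w], each order costing a factor 2 |w|. The
    factorial is given up, since only the power of |w| matters for a fixed order. *)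
Lemma exp_tail_bound (n : nat) (w : C) :
  (Cmod (exp_tail n w) <= (2 * Cmod w) ^ n * exp (Cmod w))%R.
Proof.
  revert w; induction n as [|n IH]; intros w.
  - simpl exp_tail; rewrite Cmod_Cexp, Rmult_1_l; apply exp_le_compat.
    eapply Rle_trans; [apply Rle_abs|apply re_le_Cmod].
  - assert (E := is_Cderive_mean_value (fun x => exp_tail (S n) (RtoC x * w))
      (fun x => w * exp_tail n (RtoC x * w)) 0 1
      (Cmod w * ((2 * Cmod w) ^ n * exp (Cmod w)))%R).
    cbv beta in E.
    replace (RtoC 0 * w) with (RtoC 0) in E by ring; rewrite exp_tail_0 in E.
    replace (RtoC 1 * w) with w in E by ring.
    replace (exp_tail (S n) w - 0) with (exp_tail (S n) w) in E by ring.
    eapply Rle_trans; [apply E; [lra|]|simpl pow; apply Req_le; ring].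
    intros x Hx; split.
    + eapply is_Cderive_eq; [apply (is_Cderive_exp_tail (S n) (fun x => RtoC x * w))|].
      * apply is_Cderive_mult; [apply is_Cderive_RtoC, is_derive_id|apply is_Cderive_const].
      * change (@one R_AbsRing) with 1%R; simpl Nat.pred; cbv beta; ring.
    + rewrite Cmod_mult; apply Rmult_le_compat_l; [apply Cmod_ge_0|].
      eapply Rle_trans; [apply IH|].
      assert (H : (0 <= Cmod (RtoC x * w) <= Cmod w)%R).
      { split; [apply Cmod_ge_0|].
        rewrite Cmod_mult, Cmod_R, Rabs_pos_eq by lra.
        assert (X := Cmod_ge_0 w); nra. }
      apply Rmult_le_compat.
      * apply pow_le; lra.
      * apply Rlt_le, exp_pos.
      * apply pow_incr; lra.
      * apply exp_le_compat, H.
Qed.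

Lemma exp_tail_sum (n : nat) (w : C) :
  Cexp w = sum_n (fun k => w ^ k / RtoC (INR (fact k))) n + exp_tail (S n) w.
Proof.
  induction n as [|n IH].
  - rewrite sum_O; simpl; field.
  - rewrite sum_Sn, IH; simpl exp_tail.
    change (@plus C_AbsRing) with Cplus.
    set (F := fun k => w ^ k / RtoC (INR (fact k))).
    change (sum_n F n + (exp_tail n w - F n)
      = (sum_n F n + F (S n)) + (exp_tail n w - F n - F (S n))); ring.
Qed.

(** Each factor x is absorbed by half of the exponential: x <= (2/d) exp(d x / 2). *)
Lemma pow_le_exp (j : nat) (d : R) :
  (0 < d)%R -> exists c : R, (0 <= c)%R /\ forall x, (0 <= x)%R -> (x ^ j <= c * exp (d * x))%R.
Proof.
  revert d; induction j as [|j IH]; intros d Hd.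
  - exists 1%R; split; [lra|]; intros x Hx.
    assert (H := exp_ineq1_le (d * x)); simpl; nra.
  - destruct (IH (d / 2)%R ltac:(lra)) as (c & Hc & H).
    exists (2 / d * c)%R; split.
    { apply Rmult_le_pos; [|exact Hc]; apply Rlt_le, Rdiv_lt_0_compat; lra. }
    intros x Hx; assert (H1 := exp_ineq1_le (d / 2 * x)).
    assert (H2 : (x <= 2 / d * exp (d / 2 * x))%R).
    { apply (Rmult_le_reg_l (d / 2)); [lra|].
      replace (d / 2 * (2 / d * exp (d / 2 * x)))%R with (exp (d / 2 * x)) by (field; lra).
      lra. }
    replace (exp (d * x)) with (exp (d / 2 * x) * exp (d / 2 * x))%R
      by (rewrite <- exp_plus; f_equal; field).
    replace (2 / d * c * (exp (d / 2 * x) * exp (d / 2 * x)))%R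
      with ((2 / d * exp (d / 2 * x)) * (c * exp (d / 2 * x)))%R by ring.
    simpl; apply Rmult_le_compat; [exact Hx|apply pow_le, Hx|exact H2|apply H, Hx].
Qed.

(** With r = |z|, |ln z| <= |ln r| + 2 because the argument is below pi/2 in absolute value, and
    exp(|ln r|) <= r + 1/r. Dividing by r leaves 1 + 1/r^2. *)
Lemma exp_Cln_bound (b : R) (z : C) :
  (0 < b <= Re z)%R ->
  (exp (Cmod (Cln z)) * / Cmod z <= exp 2 * (1 + / (b * b)))%R.
Proof.
  intros Hb; assert (Hm := Re_le_Cmod z).
  set (r := Cmod z) in *.
  assert (HL : (Cmod (Cln z) <= Rabs (ln r) + 2)%R).
  { replace (Cln z) with (RtoC (ln r) + Ci * RtoC (Carg z))
      by (apply C_eq; unfold r; simpl; ring).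
    eapply Rle_trans; [apply Cmod_triangle|].
    rewrite Cmod_mult, Cmod_Ci, !Cmod_R, Rmult_1_l.
    apply Rplus_le_compat_l; rewrite Carg_atan by lra.
    assert (B := atan_bound (Im z / Re z)); assert (P := PI_4).
    apply Rabs_le; lra. }
  assert (HE : (exp (Rabs (ln r)) <= r + / r)%R).
  { assert (I0 : (0 < / r)%R) by (apply Rinv_0_lt_compat; lra).
    unfold Rabs; destruct Rcase_abs.
    - rewrite exp_Ropp, exp_ln by lra; lra.
    - rewrite exp_ln by lra; lra. }
  assert (H1 : (exp (Cmod (Cln z)) <= (r + / r) * exp 2)%R).
  { eapply Rle_trans; [apply exp_le_compat, HL|]; rewrite exp_plus.
    apply Rmult_le_compat_r; [apply Rlt_le, exp_pos|exact HE]. }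
  assert (I : (0 < / r)%R) by (apply Rinv_0_lt_compat; lra).
  apply Rle_trans with ((r + / r) * exp 2 * / r)%R.
  - apply Rmult_le_compat_r; lra.
  - replace ((r + / r) * exp 2 * / r)%R with (exp 2 * (1 + / (r * r)))%R by (field; lra).
    apply Rmult_le_compat_l; [apply Rlt_le, exp_pos|].
    apply Rplus_le_compat_l, Rinv_le_contravar; nra.
Qed.

(** Half of exp(|ln z|) absorbs the power of |ln z|; the other half is kept for the exponential in
    [exp_tail_bound], whose argument is t * |ln z| with t <= 1/2. *)
Lemma log_growth_bound (b : R) (j : nat) :
  (0 < b)%R -> exists c : R, (0 <= c)%R /\ forall z : C, (b <= Re z)%R ->
    (Cmod (Cln z) ^ j * exp (Cmod (Cln z) / 2) * / Cmod z <= c)%R.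
Proof.
  intros Hb; destruct (pow_le_exp j (1/2) ltac:(lra)) as (c & Hc & H).
  exists (c * (exp 2 * (1 + / (b * b))))%R; split.
  { assert (0 < / (b * b))%R by (apply Rinv_0_lt_compat; nra).
    apply Rmult_le_pos; [exact Hc|]; apply Rmult_le_pos; [apply Rlt_le, exp_pos|lra]. }
  intros z Hz; assert (B := exp_Cln_bound b z ltac:(lra)).
  assert (L0 := Cmod_ge_0 (Cln z)); set (L := Cmod (Cln z)) in *.
  assert (Hm := Re_le_Cmod z).
  assert (I : (0 < / Cmod z)%R) by (apply Rinv_0_lt_compat; lra).
  apply Rle_trans with (c * (exp L * / Cmod z))%R; [|apply Rmult_le_compat_l; assumption].
  replace (exp L) with (exp (1 / 2 * L) * exp (L / 2))%R
    by (rewrite <- exp_plus; f_equal; field).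
  rewrite <- Rmult_assoc; apply Rmult_le_compat_r; [lra|].
  rewrite <- Rmult_assoc; apply Rmult_le_compat_r; [apply Rlt_le, exp_pos|].
  apply H, L0.
Qed.

Lemma rhp_derive_log_quotient (k : nat) :
  is_rhp_derive (log_quotient k)
    (fun z => (RtoC (INR k) * Cln z ^ Nat.pred k - Cln z ^ k) / (z * z)).
Proof.
  intros p t l Hp Hl; eapply is_Cderive_eq.
  - apply is_Cderive_mult; [apply is_Cderive_pow, rhp_derive_Cln|apply rhp_derive_inv]; eassumption.
  - cbv beta; field; apply Re_pos_neq_0, Hp.
Qed.

(** Value and derivative are bounded together, as [hermite_integral_exists] requires; the factor
    exp(L/2) >= 1 of [log_growth_bound] is simply dropped. *)
Lemma log_quotient_bound (b : R) (k : nat) :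
  (0 < b)%R -> exists M : R, forall z : C, (b <= Re z)%R ->
    (Cmod (log_quotient k z) <= M)%R /\
    (Cmod ((RtoC (INR k) * Cln z ^ Nat.pred k - Cln z ^ k) / (z * z)) <= M)%R.
Proof.
  intros Hb.
  destruct (log_growth_bound b k Hb) as (c1 & Hc1 & H1).
  destruct (log_growth_bound b (Nat.pred k) Hb) as (c2 & Hc2 & H2).
  assert (Ib : (0 < / b)%R) by (apply Rinv_0_lt_compat; exact Hb).
  assert (Ik := pos_INR k).
  exists (c1 + (INR k * c2 + c1) * / b)%R; intros z Hz.
  assert (Hz0 : z <> 0) by (apply Re_pos_neq_0; lra).
  assert (Hm := Re_le_Cmod z).
  specialize (H1 z Hz); specialize (H2 z Hz).
  assert (L0 := Cmod_ge_0 (Cln z)); set (L := Cmod (Cln z)) in *.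
  set (i := (/ Cmod z)%R) in *.
  assert (I : (0 < i <= / b)%R).
  { split; [apply Rinv_0_lt_compat; lra|apply Rinv_le_contravar; lra]. }
  assert (He : (1 <= exp (L / 2))%R).
  { rewrite <- exp_0; apply exp_le_compat; lra. }
  assert (G : forall j c, (L ^ j * exp (L / 2) * i <= c)%R -> (0 <= L ^ j * i <= c)%R).
  { intros j c H; assert (P := pow_le L j L0).
    assert (0 <= L ^ j * i)%R by (apply Rmult_le_pos; lra).
    split; [assumption|].
    replace (L ^ j * exp (L / 2) * i)%R with (L ^ j * i * exp (L / 2))%R in H by ring.
    nra. }
  apply G in H1; apply G in H2.
  assert (X : (0 <= (INR k * c2 + c1) * / b)%R) by (apply Rmult_le_pos; [nra|lra]).
  split.
  - unfold log_quotient; rewrite Cmod_div, Cmod_pow by exact Hz0.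
    unfold Rdiv; fold i; fold L; lra.
  - assert (Hzz : z * z <> 0) by (apply Cmult_neq_0; assumption).
    rewrite Cmod_div, Cmod_mult by exact Hzz.
    unfold Rdiv; rewrite Rinv_mult; fold i.
    apply Rle_trans with ((INR k * L ^ Nat.pred k + L ^ k) * (i * i))%R.
    + apply Rmult_le_compat_r; [nra|].
      unfold Cminus; eapply Rle_trans; [apply Cmod_triangle|].
      rewrite Cmod_opp, Cmod_mult, !Cmod_pow, Cmod_R, Rabs_pos_eq by exact Ik.
      fold L; lra.
    + replace ((INR k * L ^ Nat.pred k + L ^ k) * (i * i))%R
        with ((INR k * (L ^ Nat.pred k * i) + L ^ k * i) * i)%R by ring.
      apply Rle_trans with ((INR k * c2 + c1) * / b)%R; [|lra].
      apply Rmult_le_compat; try lra.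
      * assert (0 <= INR k * (L ^ Nat.pred k * i))%R by (apply Rmult_le_pos; lra); lra.
      * assert (INR k * (L ^ Nat.pred k * i) <= INR k * c2)%R
          by (apply Rmult_le_compat_l; lra); lra.
Qed.

(** The remainder of z^(-1-t) after its first n terms in powers of t. *)
Definition power_tail (n : nat) (t : R) (z : C) : C := exp_tail n (- RtoC t * Cln z) / z.

Lemma rhp_derive_power_tail (n : nat) (t : R) :
  is_rhp_derive (power_tail n t)
    (fun z => - (RtoC t * exp_tail (Nat.pred n) (- RtoC t * Cln z)
                 + exp_tail n (- RtoC t * Cln z)) / (z * z)).
Proof.
  intros p x l Hp Hl; eapply is_Cderive_eq.
  - apply is_Cderive_mult; [|apply rhp_derive_inv; eassumption].
    apply is_Cderive_exp_tail, is_Cderive_scal, rhp_derive_Cln; eassumption.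
  - cbv beta; field; apply Re_pos_neq_0, Hp.
Qed.

(** The derivative contains a tail of order m only, but the chain rule supplies the missing factor
    t, so both bounds are of order t^(m+1), uniformly in [z]. *)
Lemma power_tail_bound (b : R) (m : nat) :
  (0 < b)%R -> exists c : R, forall (t : R) (z : C),
    (0 < t <= 1/2)%R -> (b <= Re z)%R ->
    (Cmod (power_tail (S m) t z) <= c * t ^ S m)%R /\
    (Cmod (- (RtoC t * exp_tail m (- RtoC t * Cln z)
              + exp_tail (S m) (- RtoC t * Cln z)) / (z * z)) <= c * t ^ S m)%R.
Proof.
  intros Hb.
  destruct (log_growth_bound b (S m) Hb) as (c1 & Hc1 & H1).
  destruct (log_growth_bound b m Hb) as (c2 & Hc2 & H2).
  assert (Ib : (0 < / b)%R) by (apply Rinv_0_lt_compat; exact Hb).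
  set (A1 := (2 ^ S m * c1)%R); set (A2 := (2 ^ m * c2)%R).
  assert (A10 : (0 <= A1)%R) by (apply Rmult_le_pos; [apply pow_le; lra|exact Hc1]).
  assert (A20 : (0 <= A2)%R) by (apply Rmult_le_pos; [apply pow_le; lra|exact Hc2]).
  exists (A1 + (A2 + A1) * / b)%R; intros t z Ht Hz.
  assert (Hz0 : z <> 0) by (apply Re_pos_neq_0; lra).
  assert (Hm := Re_le_Cmod z).
  specialize (H1 z Hz); specialize (H2 z Hz).
  assert (L0 := Cmod_ge_0 (Cln z)); set (L := Cmod (Cln z)) in *.
  set (i := (/ Cmod z)%R) in *.
  assert (I : (0 < i <= / b)%R).
  { split; [apply Rinv_0_lt_compat; lra|apply Rinv_le_contravar; lra]. }
  assert (G : forall j c, (L ^ j * exp (L / 2) * i <= c)%R ->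
    (Cmod (exp_tail j (- RtoC t * Cln z)) * i <= 2 ^ j * c * t ^ j)%R).
  { intros j c H.
    assert (E : Cmod (- RtoC t * Cln z) = (t * L)%R).
    { rewrite Cmod_mult, Cmod_opp, Cmod_R, Rabs_pos_eq by lra; reflexivity. }
    apply Rle_trans with ((2 * (t * L)) ^ j * exp (L / 2) * i)%R.
    - apply Rmult_le_compat_r; [lra|].
      eapply Rle_trans; [apply exp_tail_bound|]; rewrite E.
      apply Rmult_le_compat_l; [apply pow_le; nra|apply exp_le_compat; nra].
    - rewrite !Rpow_mult_distr.
      replace (2 ^ j * (t ^ j * L ^ j) * exp (L / 2) * i)%R
        with ((2 ^ j * t ^ j) * (L ^ j * exp (L / 2) * i))%R by ring.
      replace (2 ^ j * c * t ^ j)%R with ((2 ^ j * t ^ j) * c)%R by ring.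
      apply Rmult_le_compat_l; [|exact H].
      apply Rmult_le_pos; apply pow_le; lra. }
  apply G in H1; apply G in H2; fold A1 in H1; fold A2 in H2.
  assert (T0 : (0 <= t ^ S m)%R) by (apply pow_le; lra).
  assert (X : (0 <= (A2 + A1) * / b)%R) by (apply Rmult_le_pos; lra).
  split.
  - unfold power_tail; rewrite Cmod_div by exact Hz0.
    unfold Rdiv; fold i; nra.
  - assert (Hzz : z * z <> 0) by (apply Cmult_neq_0; assumption).
    rewrite Cmod_div, Cmod_opp, Cmod_mult by exact Hzz.
    unfold Rdiv; rewrite Rinv_mult; fold i.
    set (w := - RtoC t * Cln z) in *.
    apply Rle_trans with ((t * (Cmod (exp_tail m w) * i) + Cmod (exp_tail (S m) w) * i) * i)%R.
    + replace ((t * (Cmod (exp_tail m w) * i) + Cmod (exp_tail (S m) w) * i) * i)%R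
        with ((t * Cmod (exp_tail m w) + Cmod (exp_tail (S m) w)) * (i * i))%R by ring.
      apply Rmult_le_compat_r; [nra|].
      eapply Rle_trans; [apply Cmod_triangle|].
      rewrite Cmod_mult, Cmod_R, Rabs_pos_eq by lra; lra.
    + apply Rle_trans with ((A2 + A1) * t ^ S m * / b)%R; [|nra].
      assert (Y1 := Cmod_ge_0 (exp_tail m w)); assert (Y2 := Cmod_ge_0 (exp_tail (S m) w)).
      assert (0 <= Cmod (exp_tail m w) * i)%R by (apply Rmult_le_pos; lra).
      assert (0 <= Cmod (exp_tail (S m) w) * i)%R by (apply Rmult_le_pos; lra).
      apply Rmult_le_compat; [nra|lra| |lra].
      assert (t * (Cmod (exp_tail m w) * i) <= t * (A2 * t ^ m))%R
        by (apply Rmult_le_compat_l; lra).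
      simpl pow in *; nra.
Qed.

(** * Finite sums and comparison of coefficients *)

Lemma sum_n_Cmult_l (c : C) (u : nat -> C) (n : nat) :
  sum_n (fun k => c * u k) n = c * sum_n u n.
Proof. apply (sum_n_mult_l (K := C_Ring)). Qed.

Lemma sum_n_Cplus (u v : nat -> C) (n : nat) :
  sum_n (fun k => u k + v k) n = sum_n u n + sum_n v n.
Proof. apply (sum_n_plus (G := C_AbelianMonoid)). Qed.

Lemma sum_n_Cext (u v : nat -> C) (n : nat) :
  (forall k, u k = v k) -> sum_n u n = sum_n v n.
Proof. apply (sum_n_ext (G := C_AbelianMonoid)). Qed.

Lemma sum_n_Cshift (u : nat -> C) (n : nat) :
  sum_n u (S n) = u O + sum_n (fun k => u (S k)) n.
Proof.
  induction n as [|n IH].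
  - rewrite sum_Sn, !sum_O; reflexivity.
  - rewrite sum_Sn, IH, sum_Sn; symmetry; apply Cplus_assoc.
Qed.

Lemma sum_n_Cmod_le (u : nat -> C) (n : nat) :
  (Cmod (sum_n u n) <= sum_n (fun k => Cmod (u k)) n)%R.
Proof.
  induction n as [|n IH]; [rewrite !sum_O; lra|].
  rewrite !sum_Sn; eapply Rle_trans; [apply Cmod_triangle|].
  apply Rplus_le_compat_r, IH.
Qed.

Lemma sum_n_Rle (u v : nat -> R) (n : nat) :
  (forall k, (u k <= v k)%R) -> (sum_n u n <= sum_n v n)%R.
Proof.
  intros H; induction n as [|n IH]; [rewrite !sum_O; apply H|].
  rewrite !sum_Sn; apply Rplus_le_compat; [exact IH|apply H].
Qed.

(** Letting t decrease to 0 kills the constant term; dividing by t reduces the degree and the order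
    of the bound together. *)
Lemma small_polynomial_eq_0 (m : nat) (d : nat -> C) (K delta : R) :
  (0 < delta)%R ->
  (forall t, (0 < t < delta)%R ->
     (Cmod (sum_n (fun k => d k * RtoC t ^ k) m)%C <= K * t ^ S m)%R) ->
  forall k, (k <= m)%nat -> d k = 0.
Proof.
  revert d; induction m as [|m IH]; intros d Hdelta H.
  - intros k Hk; replace k with O by lia.
    apply Cmod_small_eq_0; intros eps He.
    set (t := Rmin (delta / 2) (eps / (Rabs K + 1))).
    assert (K0 := Rabs_pos K); assert (K1 := Rle_abs K).
    assert (t0 : (0 < t)%R) by (apply Rmin_pos; [lra|apply Rdiv_lt_0_compat; lra]).
    assert (t1 : (t <= delta / 2)%R) by apply Rmin_l.
    assert (t2 : (t * (Rabs K + 1) <= eps)%R).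
    { apply (Rmult_le_reg_r (/ (Rabs K + 1))); [apply Rinv_0_lt_compat; lra|].
      rewrite Rmult_assoc, Rinv_r, Rmult_1_r by lra; apply Rmin_r. }
    assert (X := H t ltac:(lra)); rewrite sum_O in X.
    simpl Cpow in X; rewrite Cmult_1_r in X; simpl pow in X; nra.
  - assert (Hsplit : forall t, sum_n (fun k => d k * RtoC t ^ k) (S m)
      = d O + RtoC t * sum_n (fun k => d (S k) * RtoC t ^ k) m).
    { intros t; rewrite sum_n_Cshift, <- sum_n_Cmult_l; f_equal.
      - simpl; ring.
      - apply sum_n_Cext; intros; simpl; ring. }
    assert (d0 : d O = 0).
    { apply Cmod_small_eq_0; intros eps He.
      set (Q := sum_n (fun k => Cmod (d (S k))) m).
      assert (Q0 : (0 <= Q)%R).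
      { eapply Rle_trans; [apply Cmod_ge_0|apply (sum_n_Cmod_le (fun k => d (S k)) m)]. }
      set (A := (Rabs K + Q + 1)%R).
      (* With t <= 1 all powers of t are at most 1, so |d 0| <= t * (Q + |K|), which is at most
         [eps] for this [t]. *)
      set (t := Rmin (Rmin 1 (delta / 2)) (eps / A)).
      assert (K0 := Rabs_pos K); assert (K1 := Rle_abs K).
      assert (A0 : (0 < A)%R) by (unfold A; lra).
      assert (t0 : (0 < t)%R).
      { apply Rmin_pos; [apply Rmin_pos; lra|apply Rdiv_lt_0_compat; lra]. }
      assert (t1 : (t <= 1)%R) by (eapply Rle_trans; [apply Rmin_l|apply Rmin_l]).
      assert (t1' : (t <= delta / 2)%R) by (eapply Rle_trans; [apply Rmin_l|apply Rmin_r]).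
      assert (t2 : (t * A <= eps)%R).
      { apply (Rmult_le_reg_r (/ A)); [apply Rinv_0_lt_compat; lra|].
        rewrite Rmult_assoc, Rinv_r, Rmult_1_r by lra; apply Rmin_r. }
      assert (X := H t ltac:(lra)); rewrite Hsplit in X.
      set (P := sum_n (fun k => d (S k) * RtoC t ^ k) m) in *.
      assert (PQ : (Cmod P <= Q)%R).
      { eapply Rle_trans; [apply sum_n_Cmod_le|]; apply sum_n_Rle; intros k.
        rewrite Cmod_mult, Cmod_pow, Cmod_R, Rabs_pos_eq by lra.
        assert (C0 := Cmod_ge_0 (d (S k))).
        assert (P1 : (t ^ k <= 1 ^ k)%R) by (apply pow_incr; lra); rewrite pow1 in P1.
        nra. }
      replace (d O) with ((d O + RtoC t * P) + - (RtoC t * P)) by ring.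
      eapply Rle_trans; [apply Cmod_triangle|].
      rewrite Cmod_opp, Cmod_mult, Cmod_R, Rabs_pos_eq by lra.
      assert (T0 : (0 <= t ^ S (S m) <= t)%R).
      { split; [apply pow_le; lra|].
        assert (P1 : (t ^ S m <= 1 ^ S m)%R) by (apply pow_incr; lra); rewrite pow1 in P1.
        assert (P2 : (0 <= t ^ S m)%R) by (apply pow_le; lra).
        change (t ^ S (S m))%R with (t * t ^ S m)%R; nra. }
      assert (K * t ^ S (S m) <= Rabs K * t)%R by nra.
      unfold A in t2; nra. }
    assert (IH' : forall k, (k <= m)%nat -> d (S k) = 0).
    { apply (IH (fun k => d (S k)) Hdelta); intros t Ht.
      assert (X := H t Ht); rewrite Hsplit, d0, Cplus_0_l in X.
      rewrite Cmod_mult, Cmod_R, Rabs_pos_eq in X by lra.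
      apply (Rmult_le_reg_l t); [lra|].
      replace (t * (K * t ^ S m))%R with (K * t ^ S (S m))%R by (simpl; ring).
      exact X. }
    intros [|k] Hk; [exact d0|apply IH'; lia].
Qed.

Lemma bounded_prefix (u : nat -> R) (N : nat) :
  exists B, forall n, (n <= N)%nat -> (u n <= B)%R.
Proof.
  induction N as [|N [B HB]].
  - exists (u O); intros n Hn; replace n with O by lia; lra.
  - exists (Rmax B (u (S N))); intros n Hn.
    destruct (Nat.eq_dec n (S N)) as [->|E]; [apply Rmax_r|].
    eapply Rle_trans; [apply HB; lia|apply Rmax_l].
Qed.

Lemma series_terms_bounded (u : nat -> C) (l : C) :
  is_series (K := C_AbsRing) (V := C_NormedModule) u l ->
  exists B, forall n, (Cmod (u n) <= B)%R.
Proof.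
  intros H; destruct (is_series_Cmod _ _ H 1 ltac:(lra)) as [N0 HN0].
  destruct (bounded_prefix (fun n => Cmod (u n)) N0) as [B HB].
  (* A term beyond [N0] is a difference of two partial sums, each within 1 of the limit. *)
  exists (Rmax B 2); intros n.
  destruct (Nat.le_gt_cases n N0) as [Hn|Hn].
  - eapply Rle_trans; [apply HB, Hn|apply Rmax_l].
  - eapply Rle_trans; [|apply Rmax_r].
    destruct n as [|n]; [lia|].
    assert (X1 := HN0 n ltac:(lia)); assert (X2 := HN0 (S n) ltac:(lia)).
    rewrite sum_Sn in X2; change (@plus C_NormedModule) with Cplus in X2.
    change (Cmod (sum_n u n + u (S n) - l) <= 1)%R in X2.
    replace (u (S n)) with ((sum_n u n + u (S n) - l) + - (sum_n u n - l)) by ring.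
    eapply Rle_trans; [apply Cmod_triangle|]; rewrite Cmod_opp; lra.
Qed.

(** Convergence at [r] bounds |b_n| r^n by a constant [B], so at t <= r/2 the terms are dominated by
    a geometric series of ratio t/r <= 1/2. *)
Lemma power_series_truncation (b : nat -> C) (r : R) (m : nat) :
  (0 < r)%R ->
  (exists l, is_series (K := C_AbsRing) (V := C_NormedModule) (fun n => b n * RtoC r ^ n) l) ->
  exists K, forall (t : R) (l : C), (0 < t <= r / 2)%R ->
    is_series (K := C_AbsRing) (V := C_NormedModule) (fun n => b n * RtoC t ^ n) l ->
    (Cmod (l - sum_n (fun n => b n * RtoC t ^ n) m)%C <= K * t ^ S m)%R.
Proof.
  intros Hr [lr Hlr]; destruct (series_terms_bounded _ _ Hlr) as [B HB].
  assert (B0 : (0 <= B)%R) by (eapply Rle_trans; [apply Cmod_ge_0|apply (HB O)]).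
  exists (2 * B * / r ^ S m)%R; intros t l Ht Hl.
  set (q := (t / r)%R).
  assert (Ir : (0 < / r)%R) by (apply Rinv_0_lt_compat; exact Hr).
  assert (Hq : (0 < q <= 1/2)%R).
  { unfold q; split; [apply Rdiv_lt_0_compat; lra|].
    apply (Rmult_le_reg_r r); [exact Hr|].
    replace (t / r * r)%R with t by (field; lra); lra. }
  assert (Hterm : forall n, (Cmod (b n * RtoC t ^ n) <= B * q ^ n)%R).
  { intros n; assert (X := HB n).
    replace t with (q * r)%R by (unfold q; field; lra).
    rewrite RtoC_mult, Cpow_mult_l.
    replace (b n * (RtoC q ^ n * RtoC r ^ n)) with (RtoC q ^ n * (b n * RtoC r ^ n)) by ring.
    rewrite Cmod_mult, Cmod_pow, Cmod_R, Rabs_pos_eq by lra.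
    rewrite Rmult_comm; apply Rmult_le_compat_r; [apply pow_le; lra|exact X]. }
  set (s := sum_n (fun n => b n * RtoC t ^ n)) in *.
  (* The subtracted power makes the induction close: a new term y = q^(m+j+1) satisfies y <= 2 * (y
     - q * y) since q <= 1/2. *)
  assert (Hs : forall j, (Cmod (s (m + j)%nat - s m)
    <= B * (2 * (q ^ S m - q ^ (S m + j))))%R).
  { induction j as [|j IH].
    - rewrite !Nat.add_0_r; replace (s m - s m) with (RtoC 0) by ring.
      rewrite Cmod_0; apply Req_le; ring.
    - rewrite <- !plus_n_Sm.
      assert (E : s (S (m + j)) = s (m + j)%nat + b (S (m + j)) * RtoC t ^ S (m + j))
        by (unfold s; rewrite sum_Sn; reflexivity).
      rewrite E.
      replace (s (m + j)%nat + b (S (m + j)) * RtoC t ^ S (m + j) - s m)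
        with ((s (m + j)%nat - s m) + b (S (m + j)) * RtoC t ^ S (m + j)) by ring.
      eapply Rle_trans; [apply Cmod_triangle|].
      assert (X := Hterm (S (m + j))).
      change (S m + j)%nat with (S (m + j)) in *.
      assert (Q0 : (0 <= q ^ S (m + j))%R) by (apply pow_le; lra).
      change (q ^ S (S (m + j)))%R with (q * q ^ S (m + j))%R.
      set (y := (q ^ S (m + j))%R) in *.
      assert (B * y <= B * (2 * (y - q * y)))%R by (apply Rmult_le_compat_l; nra).
      nra. }
  assert (Hlim : forall eps, (0 < eps)%R -> (Cmod (l - s m) <= 2 * B * q ^ S m + eps)%R).
  { intros eps He; destruct (is_series_Cmod _ _ Hl eps He) as [N0 HN0].
    assert (X1 := HN0 (m + N0)%nat ltac:(lia)); fold s in X1.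
    assert (X2 := Hs N0).
    assert (Q0 : (0 <= q ^ (S m + N0))%R) by (apply pow_le; lra).
    replace (l - s m) with (- (s (m + N0)%nat - l) + (s (m + N0)%nat - s m)) by ring.
    eapply Rle_trans; [apply Cmod_triangle|]; rewrite Cmod_opp; nra. }
  replace (2 * B * / r ^ S m * t ^ S m)%R with (2 * B * q ^ S m)%R.
  - apply Rnot_lt_le; intros Hlt.
    assert (X := Hlim ((Cmod (l - s m) - 2 * B * q ^ S m) / 2)%R ltac:(lra)); lra.
  - unfold q, Rdiv; rewrite Rpow_mult_distr, pow_inv; ring.
Qed.

(** Stated for every order [k], because the comparison of coefficients involves all orders up to [m]
    at once. *)
Definition stieltjes_value (a : C) (J : nat -> C) (k : nat) : C :=
  Cln a ^ k / (RtoC 2 * a) - RtoC 1 / RtoC (INR (k + 1)) * Cln a ^ (k + 1)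
  + RtoC 1 / (RtoC (2 * PI) * Ci) * J k.

Lemma hermite_integral_log_quotient (a : C) (k : nat) :
  (0 < Re a)%R -> exists J, is_CInt (stieltjes_integrand a k) 0 1 J.
Proof.
  intros Ha; destruct (log_quotient_bound (Re a) k Ha) as [M HM].
  eapply (hermite_integral_exists (log_quotient k)); [apply rhp_derive_log_quotient|exact Ha|].
  intros z Hz; apply HM; lra.
Qed.

Lemma neg_pow (t : R) (L : C) (k : nat) :
  (- RtoC t * L) ^ k / RtoC (INR (fact k))
  = RtoC ((-1) ^ k / INR (fact k)) * L ^ k * RtoC t ^ k.
Proof.
  assert (F := INR_fact_C_neq_0 k).
  replace (- RtoC t * L) with (RtoC (-1) * (L * RtoC t)) by (rewrite RtoC_m1; ring).
  rewrite !Cpow_mult_l.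
  unfold Rdiv; rewrite RtoC_mult, RtoC_inv, RtoC_pow by apply INR_fact_neq_0.
  field; exact F.
Qed.

Lemma shifted_power_expansion (m : nat) (t : R) (z : C) :
  shifted_power t z
  = sum_n (fun k => RtoC ((-1) ^ k / INR (fact k)) * RtoC t ^ k * log_quotient k z) m
    + power_tail (S m) t z.
Proof.
  unfold shifted_power, power_tail, Cln_exp; rewrite (exp_tail_sum m).
  unfold Cdiv at 1; rewrite Cmult_plus_distr_r; f_equal.
  rewrite Cmult_comm, <- sum_n_Cmult_l; apply sum_n_Cext; intros k.
  rewrite neg_pow; unfold log_quotient, Cdiv; ring.
Qed.

(** The three terms of [hermite_value] are expanded separately. The middle one is divided by t, so
    it is taken one order further; its constant term is the pole 1/t. *)
Lemma hermite_value_expansion (a : C) (m : nat) (J : nat -> C) :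
  (0 < Re a)%R ->
  (forall k, is_CInt (stieltjes_integrand a k) 0 1 (J k)) ->
  exists K, forall (t : R) (Jt : C), (0 < t <= 1/2)%R ->
    is_CInt (hermite_integrand (shifted_power t) a) 0 1 Jt ->
    (Cmod (hermite_value t a Jt - RtoC 1 / RtoC t
      - sum_n (fun k => RtoC ((-1) ^ k / INR (fact k)) * stieltjes_value a J k * RtoC t ^ k) m)%C
     <= K * t ^ S m)%R.
Proof.
  intros Ha HJ; assert (P := two_PI_gt_2).
  destruct (power_tail_bound (Re a) m Ha) as [c Hc].
  set (L := Cmod (Cln a)).
  assert (L0 : (0 <= L)%R) by apply Cmod_ge_0.
  (* One summand for each term of [hermite_value]: the halved power, the tail of order m + 2 divided
     by t, and the integral, for which 1/(2 pi) is replaced by 1. *)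
  exists (c / 2 + (2 * L) ^ S (S m) * exp L + 4 * c)%R; intros t Jt Ht HJt.
  set (e := fun k => RtoC ((-1) ^ k / INR (fact k)) * RtoC t ^ k).
  assert (SPE : forall z, shifted_power t z
    = sum_n (fun k => e k * log_quotient k z) m + power_tail (S m) t z)
    by (intros; apply shifted_power_expansion).
  assert (Ht0 : RtoC t <> 0) by (apply RtoC_neq_0; lra).
  assert (Ha0 := Re_pos_neq_0 a Ha).
  assert (H2 : RtoC 2 <> 0) by (apply RtoC_neq_0; lra).
  assert (HPi : RtoC (2 * PI) * Ci <> 0).
  { apply Cmult_neq_0; [apply RtoC_neq_0; lra|apply Ci_neq_0]. }
  set (T := Jt - sum_n (fun k => e k * J k) m).
  (* [hermite_integrand] is linear in [q], so the remainder of the integral is the Hermite integral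
     of [power_tail] and obeys the general bound. *)
  assert (BT : (Cmod T <= 4 * (c * t ^ S m))%R).
  { apply (hermite_integral_bound (power_tail (S m) t) _ a _ _
      (rhp_derive_power_tail (S m) t) Ha).
    - intros z Hz; apply Hc; [exact Ht|lra].
    - apply (is_CInt_ext (fun u => hermite_integrand (shifted_power t) a u
        - sum_n (fun k => e k * stieltjes_integrand a k u) m)).
      + intros u _; unfold hermite_integrand; rewrite !SPE.
        assert (E : sum_n (fun k => e k * stieltjes_integrand a k u) m
          = / RtoC u * (sum_n (fun k => e k * log_quotient k
               (a - RtoC (ln (1 - u)) / (RtoC (2 * PI) * Ci))) m
             + RtoC (-1) * sum_n (fun k => e k * log_quotient k
               (a + RtoC (ln (1 - u)) / (RtoC (2 * PI) * Ci))) m)).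
        { rewrite <- sum_n_Cmult_l, <- sum_n_Cplus, <- sum_n_Cmult_l.
          apply sum_n_Cext; intros k; unfold stieltjes_integrand, Cdiv.
          rewrite RtoC_m1; ring. }
        rewrite E, RtoC_m1; unfold Cdiv; ring.
      + apply is_CInt_minus; [exact HJt|].
        apply (is_CInt_sum (fun k u => e k * stieltjes_integrand a k u) (fun k => e k * J k)).
        intros k _; apply is_CInt_scal, HJ. }
  set (T2 := exp_tail (S (S m)) (- RtoC t * Cln a)).
  assert (BT2 : (Cmod (T2 / RtoC t) <= (2 * L) ^ S (S m) * exp L * t ^ S m)%R).
  { rewrite Cmod_div, Cmod_R, Rabs_pos_eq by (try exact Ht0; lra).
    apply (Rmult_le_reg_r t); [lra|].
    replace (Cmod T2 / t * t)%R with (Cmod T2) by (field; lra).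
    eapply Rle_trans; [apply exp_tail_bound|].
    rewrite Cmod_mult, Cmod_opp, Cmod_R, Rabs_pos_eq by lra; fold L.
    replace (2 * (t * L))%R with (2 * L * t)%R by ring.
    rewrite Rpow_mult_distr.
    replace ((2 * L) ^ S (S m) * exp L * t ^ S m * t)%R
      with ((2 * L) ^ S (S m) * t ^ S (S m) * exp L)%R by (simpl; ring).
    apply Rmult_le_compat_l.
    - apply Rmult_le_pos; apply pow_le; lra.
    - apply exp_le_compat; nra. }
  set (T1 := power_tail (S m) t a).
  assert (BT1 : (Cmod T1 <= c * t ^ S m)%R) by (apply Hc; lra).
  assert (E1 : shifted_power t a = sum_n (fun k => e k * log_quotient k a) m + T1)
    by apply SPE.
  (* The sum is shifted by one: (-1)^(k+1) / (k+1)! is -(-1)^k / k! divided by k + 1, the source of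
     the factor 1/(k+1) in the formula. *)
  assert (E2 : Cln_exp t a = RtoC 1
    + (- RtoC t) * sum_n (fun k => e k * (RtoC 1 / RtoC (INR (k + 1)) * Cln a ^ (k + 1))) m + T2).
  { unfold Cln_exp; rewrite (exp_tail_sum (S m)); fold T2; f_equal.
    rewrite sum_n_Cshift; f_equal.
    - simpl; field.
    - rewrite <- sum_n_Cmult_l; apply sum_n_Cext; intros k.
      rewrite neg_pow; unfold e.
      rewrite !Nat.add_1_r.
      replace (INR (fact (S k))) with (INR (S k) * INR (fact k))%R
        by (rewrite <- mult_INR; reflexivity).
      assert (F1 := INR_fact_neq_0 k).
      assert (F2 : INR (S k) <> 0%R) by (apply not_0_INR; lia).
      replace ((-1) ^ S k / (INR (S k) * INR (fact k)))%R
        with (- ((-1) ^ k / INR (fact k)) * / INR (S k))%R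
        by (simpl pow; field; split; assumption).
      rewrite (RtoC_mult _ (/ _)), RtoC_opp, RtoC_inv by exact F2.
      simpl Cpow; field; apply RtoC_neq_0, F2. }
  assert (E3 : Jt = sum_n (fun k => e k * J k) m + T) by (unfold T; ring).
  assert (ES : sum_n (fun k => RtoC ((-1) ^ k / INR (fact k)) * stieltjes_value a J k
      * RtoC t ^ k) m
    = / RtoC 2 * sum_n (fun k => e k * log_quotient k a) m
      + (RtoC (-1) * sum_n (fun k => e k * (RtoC 1 / RtoC (INR (k + 1)) * Cln a ^ (k + 1))) m
      + / (RtoC (2 * PI) * Ci) * sum_n (fun k => e k * J k) m)).
  { rewrite <- !sum_n_Cmult_l, <- !sum_n_Cplus; apply sum_n_Cext; intros k.
    unfold stieltjes_value, e, log_quotient; rewrite RtoC_m1.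
    assert (F2 : RtoC (INR (k + 1)) <> 0) by (apply RtoC_neq_0, not_0_INR; lia).
    field; repeat split; try assumption.
    - apply Ci_neq_0.
    - apply RtoC_neq_0; lra. }
  rewrite ES; unfold hermite_value; rewrite E1, E2, E3.
  match goal with |- (Cmod ?X <= _)%R =>
    replace X with (/ RtoC 2 * T1 + T2 / RtoC t + / (RtoC (2 * PI) * Ci) * T) end.
  - eapply Rle_trans; [apply Cmod_triangle|].
    eapply Rle_trans; [apply Rplus_le_compat_r, Cmod_triangle|].
    rewrite !(Cmod_mult (/ _)), !Cmod_inv, Cmod_mult, Cmod_Ci, !Cmod_R, !Rabs_pos_eq
      by (try assumption; lra).
    assert (T0 : (0 <= t ^ S m)%R) by (apply pow_le; lra).
    assert (Ip : (0 < / (2 * PI * 1) <= 1)%R).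
    { split; [apply Rinv_0_lt_compat; lra|].
      rewrite <- Rinv_1; apply Rinv_le_contravar; lra. }
    assert (C0 := Cmod_ge_0 T).
    assert (/ (2 * PI * 1) * Cmod T <= 1 * (4 * (c * t ^ S m)))%R
      by (apply Rmult_le_compat; lra).
    lra.
  - rewrite RtoC_m1; field; repeat split; try assumption.
    + apply Ci_neq_0.
    + apply RtoC_neq_0; lra.
Qed.

Theorem proposition2 (a : C) (m : nat) (zeta : C -> C) (gamma : nat -> C)
  (Ha : (0 < Re a)%R) (Hm : (0 < m)%nat)
  (Hzeta : is_hurwitz_zeta a zeta)
  (Hgamma : are_stieltjes_constants zeta gamma) :
  ex_RInt (V := C_R_CompleteNormedModule) (stieltjes_integrand a m) 0 1 /\
  gamma m =
    Cln a ^ m / (RtoC 2 * a)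
    - RtoC 1 / RtoC (INR (m + 1)) * Cln a ^ (m + 1)
    + RtoC 1 / (RtoC (2 * PI) * Ci)
      * RInt (V := C_R_CompleteNormedModule) (stieltjes_integrand a m) 0 1.
Proof.
  split.
  { destruct (hermite_integral_log_quotient a m Ha) as [l Hl]; exists l; exact Hl. }
  set (J := fun k => RInt (V := C_R_CompleteNormedModule) (stieltjes_integrand a k) 0 1).
  assert (HJ : forall k, is_CInt (stieltjes_integrand a k) 0 1 (J k)).
  { intros k; destruct (hermite_integral_log_quotient a k Ha) as [l Hl].
    apply (RInt_correct (V := C_R_CompleteNormedModule)); exists l; exact Hl. }
  change (gamma m = stieltjes_value a J m).
  destruct Hzeta as [Hzeta _], Hgamma as (r & Hr & Hlaurent).
  set (e := fun k => RtoC ((-1) ^ k / INR (fact k))).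
  assert (Hseries : forall t, (0 < t < r)%R -> exists S : C,
    is_series (K := C_AbsRing) (V := C_NormedModule) (fun n => e n * gamma n * RtoC t ^ n) S
    /\ zeta (RtoC (1 + t)) = RtoC 1 / RtoC t + S).
  { intros t Ht.
    assert (E : RtoC (1 + t) - RtoC 1 = RtoC t) by (rewrite RtoC_plus; ring).
    destruct (Hlaurent (RtoC (1 + t))) as (S & H1 & H2).
    { rewrite E, Cmod_R, Rabs_pos_eq; lra. }
    rewrite E in H1, H2; exists S; split; assumption. }
  destruct (hermite_value_expansion a m J Ha HJ) as [K1 HK1].
  destruct (power_series_truncation (fun n => e n * gamma n) (r / 2) m) as [K2 HK2].
  { lra. }
  { destruct (Hseries (r / 2)%R ltac:(lra)) as (S & HS & _); exists S; exact HS. }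
  (* The bound 1/2 is the range of [hermite_value_expansion]. The bound r/4 is half of r/2, a radius
     at which the Laurent series is known to converge. *)
  set (delta := Rmin (1/2) (r / 4)).
  assert (Hdelta : (0 < delta)%R) by (apply Rmin_pos; lra).
  assert (Hd1 : (delta <= 1/2)%R) by apply Rmin_l.
  assert (Hd2 : (delta <= r / 4)%R) by apply Rmin_r.
  assert (D : e m * gamma m - e m * stieltjes_value a J m = 0).
  { apply (small_polynomial_eq_0 m
      (fun k => e k * gamma k - e k * stieltjes_value a J k) (K1 + K2) delta Hdelta);
      [|lia].
    intros t Ht.
    destruct (Hseries t ltac:(lra)) as (S & HS & Hz).
    destruct (hermite_integral_exists (shifted_power t) _ a _
      (rhp_derive_shifted_power t) Ha
      ltac:(intros z Hw; apply (shifted_power_bound t z (Re a)); lra)) as [Jt HJt].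
    assert (Hh := hermite_formula t a _ Jt ltac:(lra) Ha
      (Hzeta (RtoC (1 + t)) ltac:(simpl; lra)) HJt).
    assert (A1 := HK1 t Jt ltac:(lra) HJt).
    assert (A2 := HK2 t S ltac:(lra) HS).
    (* Both descriptions of zeta(1 + t) meet here: Hermite's value is replaced by 1/t + S, and the
       poles cancel. *)
    rewrite <- Hh, Hz in A1.
    replace (RtoC 1 / RtoC t + S - RtoC 1 / RtoC t) with S in A1 by ring.
    fold e in A1.
    set (V := sum_n (fun k => e k * stieltjes_value a J k * RtoC t ^ k) m) in *.
    set (W := sum_n (fun n => e n * gamma n * RtoC t ^ n) m) in *.
    replace (sum_n (fun k => (e k * gamma k - e k * stieltjes_value a J k) * RtoC t ^ k) m)
      with ((S - V) + - (S - W)).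
    - eapply Rle_trans; [apply Cmod_triangle|]; rewrite Cmod_opp.
      rewrite Rmult_plus_distr_r; apply Rplus_le_compat; assumption.
    - replace ((S - V) + - (S - W)) with (W + RtoC (-1) * V) by (rewrite RtoC_m1; ring).
      unfold V, W; rewrite <- sum_n_Cmult_l, <- sum_n_Cplus; apply sum_n_Cext.
      intros k; rewrite RtoC_m1; ring. }
  assert (He : e m <> 0).
  { apply RtoC_neq_0; unfold Rdiv; apply Rmult_integral_contrapositive; split.
    - apply pow_nonzero; lra.
    - apply Rinv_neq_0_compat, INR_fact_neq_0. }
  replace (gamma m) with (stieltjes_value a J m
    + / e m * (e m * gamma m - e m * stieltjes_value a J m)) by (field; exact He).
  rewrite D; ring.
Qed.
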